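(* Let $n$ be an even positive integer and let $f$ and $g$ be generic quadratic forms in the exterior algebra $E$ on $n$ generators. Then the Hilbert series of $E/(f,g)$ equals \[1+c(n,1)t+c(n,2)t^2+\cdots+c\left(n,\tfrac n2\right)t^{n/2},\] where $c(n,s)$ is the number of lattice paths inside the rectangle $(n+2-2s)\times(n+2)$ from the bottom left corner to the top right corner with moves of two types: $(x,y)\mapsto(x+1,y+1)$ or $(x,y)\mapsto(x-1,y+1)$. This number is given by the explicit formula \[c(n,s)=\sum_{k=0}^{\lceil s/3\rceil}\left(\binom{n}{s-k\delta}-2\binom{n}{s-2-k\delta}+\binom{n}{s-4-k\delta}\right),\qquad \delta=n-2s+4.\]
   Context: $\Bbbk$ is a field of characteristic zero and $E$ is the exterior algebra over $\Bbbk$ on $n$ generators of degree one, with its standard grading; ''generic'' means that the statement holds for $(f,g)$ in a nonempty Zariski open subset of $E_2\times E_2$. The Hilbert series of a graded algebra $A$ is $\sum_i\dim_\Bbbk(A_i)t^i$. The rectangle $(n+2-2s)\times(n+2)$ is $[0,n+2-2s]\times[0,n+2]$; paths start at $(0,0)$, end at $(n+2-2s,n+2)$, and stay inside the (closed) rectangle. Binomial coefficients $\binom{n}{b}$ with $b<0$ are $0$. *)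

(* Defs.v *)
From HB Require Import structures.
From mathcomp Require Import all_boot all_order all_algebra all_field.
From mathcomp.multinomials Require Import mpoly.

Set Implicit Arguments.
Unset Strict Implicit.
Unset Printing Implicit Defensive.

Import GRing.Theory.
Import VectorInternalTheory.
Local Open Scope ring_scope.

(* The exterior algebra of k^n, in the basis of the monomials                 *)
(* e_S = e_(i_1) * ... * e_(i_r), where S = {i_1 < ... < i_r} \subset 'I_n:   *)
(* an element is its family of coordinates, and e_S * e_T is                  *)
(* (-1)^inv * e_(S :|: T) if S and T are disjoint, with inv the number of     *)
(* pairs (i, j) in S x T with j < i, and 0 otherwise.  The lemmas extX_sqr,   *)
(* extX_anti and extb_prod below recover the usual presentation.              *)
Definition extalg (k : fieldType) (n : nat) : Type := {ffun {set 'I_n} -> k^o}.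

Section ExteriorAlgebra.

Variables (k : fieldType) (n : nat).
Local Notation E := (extalg k n).
Implicit Types (S T U : {set 'I_n}) (u v w : E).

HB.instance Definition _ := Vector.copy E {ffun {set 'I_n} -> k^o}.

Definition ext_inv S T : nat := (\sum_(i in S) \sum_(j in T) (j < i))%N.

Definition ext_sign S T : k :=
  if [disjoint S & T] then (-1) ^+ ext_inv S T else 0.

Definition extb S : E := [ffun A => (A == S)%:R : k^o].

Definition ext_mul u v : E :=
  \sum_S \sum_T (u S * v T * ext_sign S T : k) *: extb (S :|: T).

Lemma extb_coord u : u = \sum_S (u S : k) *: extb S.
Proof.
apply/ffunP=> A; rewrite sum_ffunE (bigD1 A) //= big1 ?addr0 => [|S SA].
  by rewrite !ffunE eqxx /= /GRing.scale /= mulr1.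
by rewrite !ffunE eq_sym (negPf SA) scaler0.
Qed.

Lemma ext_mulDl : left_distributive ext_mul +%R.
Proof.
move=> u v w; rewrite /ext_mul -big_split; apply: eq_bigr => S _.
by rewrite -big_split; apply: eq_bigr => T _; rewrite !ffunE !mulrDl scalerDl.
Qed.

Lemma ext_mulDr : right_distributive ext_mul +%R.
Proof.
move=> u v w; rewrite /ext_mul -big_split; apply: eq_bigr => S _.
rewrite -big_split; apply: eq_bigr => T _.
by rewrite !ffunE mulrDr mulrDl scalerDl.
Qed.

Lemma ext_mulZl (a : k) u v : a *: ext_mul u v = ext_mul (a *: u) v.
Proof.
rewrite /ext_mul scaler_sumr; apply: eq_bigr => S _.
rewrite scaler_sumr; apply: eq_bigr => T _.
by rewrite scalerA !ffunE -!mulrA.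
Qed.

Lemma ext_mulZr (a : k) u v : a *: ext_mul u v = ext_mul u (a *: v).
Proof.
rewrite /ext_mul scaler_sumr; apply: eq_bigr => S _.
rewrite scaler_sumr; apply: eq_bigr => T _.
by rewrite scalerA !ffunE !mulrA [u S * _]mulrC.
Qed.

Lemma ext_mul_suml I (r : seq I) (F : I -> E) v :
  ext_mul (\sum_(i <- r) F i) v = \sum_(i <- r) ext_mul (F i) v.
Proof.
elim: r => [|i r IH]; last by rewrite !big_cons ext_mulDl IH.
by rewrite !big_nil -[0 in LHS](scale0r (0 : E)) -ext_mulZl scale0r.
Qed.

Lemma ext_mul_sumr I (r : seq I) (F : I -> E) u :
  ext_mul u (\sum_(i <- r) F i) = \sum_(i <- r) ext_mul u (F i).
Proof.
elim: r => [|i r IH]; last by rewrite !big_cons ext_mulDr IH.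
by rewrite !big_nil -[0 in LHS](scale0r (0 : E)) -ext_mulZr scale0r.
Qed.

Lemma ext_mulb S T : ext_mul (extb S) (extb T) = ext_sign S T *: extb (S :|: T).
Proof.
rewrite /ext_mul (bigD1 S) //= (bigD1 T) //= !ffunE !eqxx !mul1r.
rewrite !big1 ?addr0 // => [S' nS|T' nT].
  by rewrite big1 // => T' _; rewrite ffunE (negPf nS) !mul0r scale0r.
by rewrite !ffunE (negPf nT) mulr0 mul0r scale0r.
Qed.

Lemma ext_signA S T U :
  ext_sign S T * ext_sign (S :|: T) U = ext_sign T U * ext_sign S (T :|: U).
Proof.
rewrite /ext_sign.
have -> : [disjoint S :|: T & U] = [disjoint S & U] && [disjoint T & U].
  by rewrite -!setI_eq0 setIUl setU_eq0.
have -> : [disjoint S & T :|: U] = [disjoint S & T] && [disjoint S & U].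
  by rewrite -!setI_eq0 setIUr setU_eq0.
case dST: [disjoint S & T]; case dSU: [disjoint S & U];
  case dTU: [disjoint T & U]; rewrite ?mul0r ?mulr0 //=.
rewrite -!exprD; congr (_ ^+ _); rewrite /ext_inv.
have -> : (\sum_(i in S :|: T) \sum_(j in U) (j < i) =
    \sum_(i in S) \sum_(j in U) (j < i) +
    \sum_(i in T) \sum_(j in U) (j < i))%N.
  by rewrite -bigU //=; apply: eq_bigl => i; rewrite !inE.
have -> : (\sum_(i in S) \sum_(j in T :|: U) (j < i) =
    \sum_(i in S) \sum_(j in T) (j < i) +
    \sum_(i in S) \sum_(j in U) (j < i))%N.
  rewrite -big_split; apply: eq_bigr => i _.
  by rewrite -bigU //=; apply: eq_bigl => j; rewrite !inE.
by rewrite addnA addnC.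
Qed.

Lemma extb_ind (P : E -> Prop) :
  (forall (a : k) u v, P u -> P v -> P (a *: u + v)) ->
  (forall S, P (extb S)) -> forall u, P u.
Proof.
move=> Plin Pb u; rewrite (extb_coord u).
have P0 : P 0 by rewrite -(addNr (extb set0)) -scaleN1r; apply: Plin.
elim/big_rec: _ => // S v _ Pv; exact: Plin.
Qed.

Lemma ext_mulA : associative ext_mul.
Proof.
move=> u v w; elim/extb_ind: u => [a u u' IH IH'|S].
  by rewrite !ext_mulDl -!ext_mulZl IH IH'.
elim/extb_ind: v => [a v v' IH IH'|T].
  by rewrite !(ext_mulDl, ext_mulDr) -!(ext_mulZl, ext_mulZr) IH IH'.
elim/extb_ind: w => [a w w' IH IH'|U].
  by rewrite !ext_mulDr -!ext_mulZr IH IH'.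
by rewrite !ext_mulb -ext_mulZl -ext_mulZr !ext_mulb !scalerA ext_signA setUA.
Qed.

Lemma ext_mul1l : left_id (extb set0) ext_mul.
Proof.
move=> u; rewrite {1}(extb_coord u) ext_mul_sumr [RHS]extb_coord.
apply: eq_bigr => S _; rewrite -ext_mulZr ext_mulb set0U /ext_sign /ext_inv.
by rewrite -setI_eq0 set0I eqxx big_set0 expr0 scale1r.
Qed.

Lemma ext_mul1r : right_id (extb set0) ext_mul.
Proof.
move=> u; rewrite {1}(extb_coord u) ext_mul_suml [RHS]extb_coord.
apply: eq_bigr => S _; rewrite -ext_mulZl ext_mulb setU0 /ext_sign /ext_inv.
rewrite -setI_eq0 setI0 eqxx big1 ?expr0 ?scale1r // => i _.
by rewrite big_set0.
Qed.

Lemma ext_oner_neq0 : extb set0 != 0.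
Proof.
by apply/eqP => /ffunP /(_ set0) /eqP; rewrite !ffunE eqxx oner_eq0.
Qed.

HB.instance Definition _ := GRing.Zmodule_isNzRing.Build E
  ext_mulA ext_mul1l ext_mul1r ext_mulDl ext_mulDr ext_oner_neq0.
HB.instance Definition _ := GRing.Lmodule_isLalgebra.Build k E ext_mulZl.
HB.instance Definition _ := GRing.Lalgebra_isAlgebra.Build k E ext_mulZr.
HB.instance Definition _ := Algebra_isFalgebra.Build k E.

Definition extX (i : 'I_n) : E := extb [set i].

Lemma extb_mul S T : extb S * extb T = ext_sign S T *: extb (S :|: T).
Proof. exact: ext_mulb. Qed.

Lemma extX_sqr i : extX i * extX i = 0.
Proof. by rewrite extb_mul /ext_sign -setI_eq0 setIid -cards_eq0 cards1 scale0r. Qed.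

Lemma extX_anti i j : extX i * extX j = - (extX j * extX i).
Proof.
have [->|nij] := eqVneq i j; first by rewrite extX_sqr oppr0.
have nji : j != i by rewrite eq_sym.
rewrite !extb_mul /ext_sign !disjoints1 !inE nij nji.
rewrite /ext_inv !big_set1 setUC -scaleNr.
congr (_ *: _); case: ltngtP => [_|_|/val_inj eij] /=.
- by rewrite ?expr0 ?expr1 ?opprK.
- by rewrite ?expr0 ?expr1 ?opprK.
- by rewrite eij eqxx in nij.
Qed.

Lemma extb_prod S : extb S = \prod_(i <- enum S) extX i.
Proof.
have: sorted ltn (map val (enum S)).
  have := iota_ltn_sorted 0 n; rewrite -val_enum_ord enumT => /(subseq_sorted ltn_trans); apply.
  exact/map_subseq/filter_subseq.
rewrite -{2}[S]set_enum; elim: (enum S) => [|i s IH] /= lt_is.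
  by rewrite big_nil; congr extb; apply/setP=> i; rewrite !inE.
rewrite big_cons -IH ?(path_sorted lt_is) // extb_mul.
have i_lt j : j \in s -> (i < j)%N.
  move=> js; apply: (allP (order_path_min ltn_trans lt_is)).
  exact: map_f.
rewrite /ext_sign disjoints1 inE ifT; last first.
  by apply/negP=> /i_lt; rewrite ltnn.
rewrite /ext_inv big_set1 big1 => [|j]; last first.
  by rewrite inE => /i_lt /ltnW; rewrite leqNgt => /negPf ->.
by rewrite expr0 scale1r; congr extb; apply/setP=> j; rewrite !inE.
Qed.

Definition ext_deg (d : nat) : {vspace E} :=
  <<[seq extb A | A in [pred A : {set 'I_n} | #|A| == d]]>>%VS.

(* Two-sided, as E * <<f, g>> * E is spanned by the u * h * v, h in <<f, g>>. *)
Definition ext_ideal (f g : E) : {vspace E} :=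
  (fullv * <<[:: f; g]>> * fullv)%VS.

(* The coefficient of t^d in the Hilbert series of E / I, for a homogeneous   *)
(* ideal I.  The component (E / I)_d is the image of E_d, that is             *)
(* E_d / (E_d :&: I), and E_d :\: I is a complement of E_d :&: I in E_d.      *)
Definition hilbert_coef (I : {vspace E}) (d : nat) : nat :=
  \dim (ext_deg d :\: I).

End ExteriorAlgebra.

Section Zariski.

Variables (k : fieldType) (V : vectType k).

(* V is identified with an affine space over k through the coordinates v2r;   *)
(* the notion does not depend on them, since a linear change of coordinates   *)
(* preserves polynomials.                                                     *)
Definition zariski_open (U : V -> Prop) : Prop :=
  exists P : {mpoly k[dim V]} -> Prop,
    forall v, U v <-> exists2 p, P p & p.@[fun i => v2r v 0 i] != 0.

Definition generically (Q : V -> Prop) : Prop :=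
  exists U : V -> Prop,
    [/\ zariski_open U, exists v, U v & forall v, U v -> Q v].

End Zariski.

Section LatticePaths.

Variables w h : nat.

(* The lattice points of [0, w] x [0, h]. *)
Local Notation point := ('I_w.+1 * 'I_h.+1)%type.

Definition lattice_step : rel point := fun u v =>
  ((v.1 == u.1.+1 :> nat) || (u.1 == v.1.+1 :> nat)) && (v.2 == u.2.+1 :> nat).

Definition is_lattice_path (p : seq point) : bool :=
  path lattice_step (ord0, ord0) p &&
  (last (ord0, ord0) p == (ord_max, ord_max)).

Lemma size_lattice_path p : is_lattice_path p -> size p = h.
Proof.
case/andP => pp lp.
suff sz x y : path lattice_step (x, y) p -> last (x, y) p == (ord_max, ord_max) ->
    (y + size p)%N = h.
  exact: sz pp lp.
elim: p x y {pp lp} => [|[x' y'] p IH] x y /=.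
  by move=> _ /eqP[_ ->]; rewrite addn0.
case/andP=> /andP[_ /= /eqP y'E] pp lp.
by apply: etrans (IH _ _ pp lp); rewrite y'E addSnnS.
Qed.

(* By size_lattice_path, tuples of length h account for all the paths. *)
Definition num_lattice_paths : nat :=
  #|[set p : h.-tuple point | is_lattice_path p]|.

End LatticePaths.

Definition lattice_c (n s : nat) : nat :=
  num_lattice_paths (n + 2 - 2 * s) (n + 2).

(* 'C(n, b) for an integer b, with value 0 when b < 0. *)
Definition binz (n : nat) (b : int) : int :=
  if b is Posz m then 'C(n, m)%:Z else 0.

(* Main.v *)
From HB Require Import structures.
Require Import Defs.
From mathcomp Require Import all_boot all_order all_fingroup all_algebra all_field.
From mathcomp.multinomials Require Import mpoly.
From mathcomp Require Import zify ring.

Set Implicit Arguments.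
Unset Strict Implicit.
Unset Printing Implicit Defensive.

Import Order.TTheory GRing.Theory Num.Theory VectorInternalTheory.

(** Write n = 2m, pair the generators of E, and put z_i = x_(2i) x_(2i+1).  The
dimension of the degree d part of (f, g) is the rank of a matrix that is linear
in (f, g).  A lower bound for this rank at one pair therefore holds on a Zariski
open set, whereas an upper bound is needed at every pair.  Both come from the
diagonal pairs f = sum_i z_i, g = sum_i lam_i z_i, for which everything becomes
a count of walks.

A monomial of E is a word of m letters; its letter i tells which of x_(2i),
x_(2i+1) occur.  Read the word as a walk: both generators make a step down, none
a step up, exactly one a flat step (in two colours).  One letter is two
consecutive moves of a lattice path, and c(n, d) becomes the number of strip
words, the walks of m letters from 1 to m + 1 - d that stay strictly between 0
and m + 2 - d ([lattice_c_words]).  The dual of the degree d part of E / (f, g)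
consists of the functions on words of degree d that are killed by the operators
[contract 1] and [contract lam], the transposes of the products by f and g.

For some lam there are at most c(n, d) independent such functions
([strip_determined_exists]): a solution that vanishes on the strip words is
zero.  The induction on m needs the more general equations
contract 1 ^ a phi = 0, contract lam phi = 0, which belong to walks that start at
height a.  When the first weight is 0, splitting off the first letter turns the
equations for a into those for a + 1, a and a - 1, that is, the first step of the
walk.  Injectivity is an open condition, so a generic first weight does as well.
A walk that reaches the upper barrier contributes nothing because contract lam is
injective in degrees above m, a Lefschetz property.

For generic lam there are at least c(n, d) of them ([walk_form_annihilated],
[det_walk_gram_neq0]).  The steps of a strip word that cross a given level form
a track, on which ups and downs alternate and the ups are one more than the
downs.  On a track with q downs consider the determinant with the 2q + 1 rows
(w_i lam_i^a for a < q, lam_i^b for b <= q), a catalecticant of the rational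
normal curve.  It is multilinear in the w_i, and column operations show that it
is invariant under the translations w_i -> w_i + t and w_i -> w_i + t lam_i: its
coefficients form a solution, and so do those of the product over the tracks.
For lam_i = t^i the leading terms of these solutions are triangular in the strip
words, whence their independence.

The bound passes from diagonal pairs to all pairs as follows ([dim_ideal_le]).
Invertible linear substitutions of the generators do not enlarge the rank.
Through a diagonal pair with distinct lam_i there is, in every tangent direction,
a cubic curve of pairs that are substituted from diagonal ones.  The minors that
vanish along all these curves have no lowest order term at the diagonal pair, so
they vanish identically ([vanish_along_curves]).

The explicit formula is the reflection principle for walks between two barriers
([strip_walks_reflected]). *)

(** * Lattice paths and words *)

Fixpoint strip_walks (w e N x : nat) : nat :=
  if N is N'.+1 then
    (if x < w then strip_walks w e N' x.+1 else 0) +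
    (if 0 < x then strip_walks w e N' x.-1 else 0)
  else x == e.

Lemma big_tuple_cons (T : finType) N (F : N.+1.-tuple T -> nat) :
  \sum_t F t = \sum_a \sum_(t : N.-tuple T) F [tuple of a :: t].
Proof.
rewrite pair_bigA /=.
rewrite (reindex (fun p : T * N.-tuple T => [tuple of p.1 :: p.2])) //=.
exists (fun t : N.+1.-tuple T => (thead t, [tuple of behead t])) => [[a t] _|t _] /=.
  by congr pair; apply/val_inj.
by rewrite [RHS]tuple_eta.
Qed.

Lemma sum_neighbours (F : nat -> nat) w x : x <= w ->
  \sum_(0 <= i < w.+1 | (i == x.+1) || (x == i.+1)) F i =
  (if x < w then F x.+1 else 0) + (if 0 < x then F x.-1 else 0).
Proof.
move=> xw; rewrite big_mkcond /=.
transitivity (\sum_(0 <= i < w.+1) ((if i == x.+1 then F i else 0) +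
                                    (if x == i.+1 then F i else 0))).
  by apply: eq_bigr => i _; case: (i =P x.+1) => h1; case: (x =P i.+1) => h2 //=; lia.
rewrite big_split -!big_mkcond /= big_nat1_eq; congr (_ + _).
case: x xw => [|x] xw /=; first by rewrite big_pred0_eq.
under eq_bigl do rewrite eqSS eq_sym.
by rewrite big_nat1_eq leqW.
Qed.

(** The second coordinate of a lattice point is the time, so that a path is a
walk of its first coordinate. *)
Lemma paths_strip_walks w h N (x : 'I_w.+1) (y : 'I_h.+1) : y + N = h ->
  \sum_(p : N.-tuple ('I_w.+1 * 'I_h.+1))
     (path (@lattice_step w h) (x, y) p && (last (x, y) p == (ord_max, ord_max)))
  = strip_walks w w N x.
Proof.
elim: N x y => [|N IH] x y yN.
  rewrite (big_pred1 [tuple]) => [|t]; last by rewrite [t]tuple0 /= eqxx.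
  rewrite /= xpair_eqE; congr (nat_of_bool _).
  have -> : y = ord_max by apply/val_inj => /=; lia.
  by rewrite eqxx andbT.
rewrite big_tuple_cons /=.
have lty : y.+1 < h.+1 by lia.
transitivity (\sum_(x' : 'I_w.+1)
   if (x' == x.+1 :> nat) || (x == x'.+1 :> nat) then strip_walks w w N x' else 0).
  transitivity (\sum_(x' < w.+1) \sum_(y' < h.+1)
      \sum_(t : N.-tuple ('I_w.+1 * 'I_h.+1))
     (lattice_step (x, y) (x', y') && path (@lattice_step w h) (x', y') t &&
     (last (x', y') t == (ord_max, ord_max)))).
    by rewrite [RHS]pair_bigA; apply: eq_bigr => -[].
  apply: eq_bigr => x' _.
  rewrite (bigD1 (Ordinal lty)) //= [X in _ + X]big1 ?addn0; last first.
    move=> y' ny'; rewrite big1 // => t _; rewrite /lattice_step /=.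
    have -> : (y' == y.+1 :> nat) = false by apply: contraNF ny' => /eqP E; apply/eqP/val_inj.
    by rewrite andbF.
  rewrite /lattice_step /= eqxx andbT; case: ifP => _ /=; last by rewrite big1.
  by rewrite IH //=; lia.
rewrite -big_mkcond /= -(big_mkord (fun x' => (x' == x.+1) || (x == x'.+1 :> nat)) (strip_walks w w N)).
by rewrite sum_neighbours // -ltnS.
Qed.

(** The last step to the wall w is forced, as the first step from 0 is; after
both are dropped, a walk has as many steps as the algebra has generators. *)
Lemma strip_walks_last w N x : 0 < w -> x <= w ->
  strip_walks w w N.+1 x = strip_walks w w.-1 N x.
Proof.
move=> w0; elim: N x => [|N IH] x xw.
  rewrite /=; case: (ltngtP x w) xw => // [xw|->] _.
    by case: posnP => [x0|x0]; lia.
  by rewrite w0; lia.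
rewrite [LHS]/= -/(strip_walks w w N.+1) -/(strip_walks w w N.+1 x.-1) /=.
congr (_ + _); case: ifP => // h; rewrite -IH //; lia.
Qed.

Lemma lattice_c_walks n s : (s <= n./2)%N ->
  lattice_c n s = strip_walks (n + 2 - 2 * s) (n + 1 - 2 * s) n 1.
Proof.
move=> sn; rewrite /lattice_c /num_lattice_paths.
set w := n + 2 - 2 * s; have w0 : 0 < w by rewrite /w; lia.
rewrite -sum1dep_card big_mkcond /=.
transitivity (strip_walks w w (n + 2) (ord0 : 'I_w.+1)).
  by rewrite -(@paths_strip_walks _ (n + 2) _ _ ord0).
rewrite addn2 [LHS]/= -/(strip_walks w w n.+1 1) w0 strip_walks_last //.
by rewrite addn0; congr strip_walks; rewrite /w; lia.
Qed.

Definition letter : predArgType := (bool * bool)%type.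
Definition empty : letter := (false, false).
Definition full : letter := (true, true).

Definition word m : predArgType := {ffun 'I_m -> letter}.

Definition word_step (a : nat) (c : letter) : nat :=
  match c with (false, false) => a.+1 | (true, true) => a.-1 | _ => a end.

(** The walk s starts at a, stays strictly between the barriers 0 and L, and
ends next to the upper one. *)
Fixpoint strip_seq (L a : nat) (s : seq letter) : bool :=
  (0 < a < L) && (if s is c :: s' then strip_seq L (word_step a c) s' else a == L.-1).

Definition strip_word L a m (w : word m) : bool := strip_seq L a (codom w).

Definition consw m (c : letter) (w : word m) : word m.+1 :=
  [ffun i => if unlift ord0 i is Some j then w j else c].
Definition tailw m (w : word m.+1) : word m := [ffun i => w (lift ord0 i)].

Lemma consw0 m c (w : word m) : consw c w ord0 = c.
Proof. by rewrite ffunE unlift_none. Qed.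
Lemma conswS m c (w : word m) i : consw c w (lift ord0 i) = w i.
Proof. by rewrite ffunE liftK. Qed.
Lemma tailwK m (w : word m.+1) : consw (w ord0) (tailw w) = w.
Proof.
by apply/ffunP => i; rewrite ffunE; case: unliftP => [j|] ->; rewrite ?ffunE.
Qed.
Lemma conswK m c (w : word m) : tailw (consw c w) = w.
Proof. by apply/ffunP => i; rewrite !ffunE liftK. Qed.

Lemma codom_consw m c (w : word m) : codom (consw c w) = c :: codom w.
Proof.
rewrite /codom /image_mem enum_ordSl /= consw0 -map_comp; congr (_ :: _).
by apply: eq_map => i; rewrite /= conswS.
Qed.

Lemma big_consw (R : Type) (idx : R) (op : Monoid.com_law idx) m (F : word m.+1 -> R) :
  \big[op/idx]_w F w = \big[op/idx]_c \big[op/idx]_(w : word m) F (consw c w).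
Proof.
rewrite pair_bigA /= (reindex (fun p : letter * word m => consw p.1 p.2)) //=.
exists (fun w : word m.+1 => (w ord0, tailw w)) => [[c w] _|w _] /=.
  by rewrite consw0 conswK.
exact: tailwK.
Qed.

Lemma big_letter (R : Type) (idx : R) (op : Monoid.com_law idx) (F : letter -> R) :
  \big[op/idx]_c F c = op (op (F (false, false)) (F (true, true)))
                          (op (F (true, false)) (F (false, true))).
Proof.
rewrite (eq_bigr (fun c => F (c.1, c.2))); last by case.
rewrite -(pair_bigA _ (fun a b => F (a, b))) /= !big_bool /=.
by rewrite -!Monoid.mulmA; rewrite [RHS](Monoid.mulmCA); congr (op _ _);
  rewrite [RHS]Monoid.mulmCA; congr (op _ _); rewrite Monoid.mulmC.
Qed.

(** Two consecutive moves of a walk between the odd heights of [0, 2(L - 1)] are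
one letter.  Only the flat letters can be read in two ways, up then down or down
then up, and at an odd height neither of them leaves the strip. *)
Lemma card_strip_words L a m : 0 < a < L ->
  #|[set w : word m | strip_word L a w]| =
  strip_walks (2 * L.-1) (2 * L.-1).-1 (2 * m) (2 * a).-1.
Proof.
rewrite -sum1dep_card big_mkcond /=.
elim: m a => [|m IH] a aL.
  rewrite (big_pred1 [ffun i => (true, true)]) => [|w]; last first.
    by rewrite /=; apply/esym/eqP/ffunP => -[].
  rewrite /strip_word /codom /image_mem enum_ord0 /= aL.
  by case: (a =P L.-1) => h /=; lia.
rewrite big_consw big_letter (_ : 2 * m.+1 = (2 * m).+2); last lia.
pose V b := \sum_(w : word m) (if strip_word L b w then 1 else 0).
have E c : \sum_(w : word m) (if strip_word L a (consw c w) then 1 else 0) = V (word_step a c).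
  by apply: eq_bigr => w _; rewrite {1}/strip_word codom_consw /= aL.
rewrite !E /=.
have Vin b : 0 < b < L -> V b = strip_walks (2 * L.-1) (2 * L.-1).-1 (2 * m) (2 * b).-1.
  exact: IH.
have Vout b : ~~ (0 < b < L) -> V b = 0.
  move=> nb; rewrite /V big1 // => w _; rewrite /strip_word.
  by case: (codom w) => [|? ?] /=; rewrite (negPf nb).
have h1 : ((2 * a).-1 < 2 * L.-1) = true by lia.
have h2 : (0 < (2 * a).-1) = true by lia.
have h3 : (2 * a).-1.+1 = 2 * a by lia.
have h4 : ((2 * a).-2 < 2 * L.-1) = true by lia.
have h5 : (2 * a).-2.+1 = (2 * a).-1 by lia.
rewrite h1 h2 h3 h4 h5 (Vin a aL).
have -> : V a.+1 = if 2 * a < 2 * L.-1 then strip_walks (2 * L.-1) (2 * L.-1).-1 (2 * m) (2 * a).+1 else 0.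
  case: ifP => h; last by rewrite Vout //; lia.
  by rewrite Vin; last lia; congr strip_walks; lia.
have -> : V a.-1 = if 0 < (2 * a).-2 then strip_walks (2 * L.-1) (2 * L.-1).-1 (2 * m) (2 * a).-2.-1 else 0.
  case: ifP => h; last by rewrite Vout //; lia.
  by rewrite Vin; last lia; congr strip_walks; lia.
lia.
Qed.

Lemma lattice_c_words m s : s <= m ->
  lattice_c (m.*2) s = #|[set w : word m | strip_word (m.+2 - s) 1 w]|.
Proof.
move=> sm; rewrite lattice_c_walks ?doubleK // card_strip_words; last lia.
by congr strip_walks; lia.
Qed.

(** * Tracks of a walk in a strip *)

Section CountBelow.
Variable m : nat.
Implicit Type P : pred 'I_m.

Definition count_below P (i : nat) : nat := #|[pred l : 'I_m | P l & l < i]|.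

Lemma count_below0 P : count_below P 0 = 0.
Proof. by apply: eq_card0 => l; rewrite !inE andbF. Qed.

Lemma count_belowS P (i : 'I_m) : count_below P i.+1 = count_below P i + P i.
Proof.
rewrite /count_below (cardD1 i) [RHS]addnC !inE ltnSn andbT; congr (_ + _).
apply: eq_card => l; rewrite !inE ltnS leq_eqVlt.
by rewrite -val_eqE; case: (ltngtP l i); rewrite ?andbF ?andbT.
Qed.

Lemma count_below_le P i j : i <= j -> count_below P i <= count_below P j.
Proof.
move=> ij; apply/subset_leq_card/subsetP => l; rewrite !inE => /andP[-> li].
exact: leq_trans li ij.
Qed.

Lemma count_below_lt P (i j : 'I_m) : P i -> i < j -> count_below P i < count_below P j.
Proof.
move=> Pi ij; apply: leq_trans (count_below_le P ij).
by rewrite count_belowS Pi addn1.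
Qed.

Lemma count_below_inj P (i j : 'I_m) : P i -> P j ->
  count_below P i = count_below P j -> i = j.
Proof.
move=> Pi Pj e; apply/val_inj; case: (ltngtP i j) => // h.
  by have := count_below_lt Pi h; rewrite e ltnn.
by have := count_below_lt Pj h; rewrite e ltnn.
Qed.

Lemma count_below_nth P i r : i <= m -> r < count_below P i ->
  exists j : 'I_m, [/\ P j, j < i & count_below P j = r].
Proof.
elim: i => [|i IH] im; first by rewrite count_below0.
rewrite (count_belowS P (Ordinal im)) /=.
case Pi: (P (Ordinal im)); last first.
  by rewrite addn0 => /(IH (ltnW im))[j [Pj ji e]]; exists j; split=> //; apply: ltnW.
rewrite addn1 ltnS leq_eqVlt => /predU1P[->|/(IH (ltnW im))[j [Pj ji e]]].
  by exists (Ordinal im).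
by exists j; split=> //; apply: ltnW.
Qed.
End CountBelow.

Definition is_single (c : letter) : bool := c.1 != c.2.

Section Tracks.
Variables (m L : nat) (w : word m).

Definition height (i : nat) : nat := foldl word_step 1 (take i (codom w)).

Definition track (i : 'I_m) : nat := if w i == full then (height i).-1 else height i.

(** A flat letter gets a color of its own, in which it counts as an up; it then is
a 1 x 1 block of the determinant and needs no separate treatment. *)
Definition color (i : 'I_m) : nat + 'I_m := if is_single (w i) then inr i else inl (track i).

Definition ups c : pred 'I_m := [pred l | (w l != full) && (color l == c)].
Definition downs c : pred 'I_m := [pred l | (w l == full) && (color l == c)].
(** The power of lam_i in the column j of the determinant of a track. *)
Definition exponent (j : 'I_m) : nat := count_below (downs (color j)) j.

Lemma heightS (i : 'I_m) : height i.+1 = word_step (height i) (w i).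
Proof.
rewrite /height (take_nth (w i)); last by rewrite size_codom card_ord.
by rewrite foldl_rcons /codom /image_mem (nth_map i) ?size_enum_ord // nth_ord_enum.
Qed.

Lemma color_full j : w j == full -> color j = inl (height j).-1.
Proof. by move=> wj; rewrite /color /track wj (eqP wj). Qed.

Lemma color_single j : is_single (w j) -> color j = inr j.
Proof. by rewrite /color => ->. Qed.

Lemma color_empty j : ~~ is_single (w j) -> w j != full -> color j = inl (height j).
Proof. by rewrite /color /track => /negPf -> /negPf ->. Qed.

Lemma color_eq_single i j : is_single (w i) -> color i = color j -> i = j.
Proof. by move=> si; rewrite (color_single si) /color; case: ifP => // _ []. Qed.

Hypothesis wL : strip_word L 1 w.

Lemma strip_seqP a s : strip_seq L a s ->
  (forall i, 0 < foldl word_step a (take i s) < L) /\ foldl word_step a s = L.-1.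
Proof.
elim: s a => [|c s IH] a /= /andP[aL]; first by move/eqP.
by move=> /IH[h e]; split=> // -[|i] //=.
Qed.

Lemma height_strip i : 0 < height i < L.
Proof. exact: (strip_seqP wL).1. Qed.

Lemma height_last : height m = L.-1.
Proof.
rewrite /height take_oversize ?size_codom ?card_ord //.
exact: (strip_seqP wL).2.
Qed.

(** Ups and downs across a level alternate, starting with an up because the walk
starts below every level t > 0. *)
Lemma ups_downs_level t i : 0 < t -> i <= m ->
  count_below (ups (inl t)) i = count_below (downs (inl t)) i + (t < height i).
Proof.
move=> t0; elim: i => [|i IH] im.
  by rewrite !count_below0 /height take0 /= ltnNge t0.
pose o := Ordinal im; rewrite !(count_belowS _ o) (heightS o) IH; last exact: ltnW.
rewrite /ups /downs /=; have := height_strip o; have := height_strip o.+1.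
rewrite (heightS o) /color /track /=.
by case: (w o) => -[] [] //=; rewrite ?(inj_eq inl_inj); move: (height i) => h; lia.
Qed.

Lemma downs_single j i : count_below (downs (inr j)) i = 0.
Proof.
apply: eq_card0 => l; rewrite !inE; apply/negP => /andP[/andP[wl]].
by rewrite (color_full wl).
Qed.

Lemma ups_single j (i : nat) : is_single (w j) -> count_below (ups (inr j)) i = (j < i).
Proof.
move=> sj; rewrite /count_below; case ji: (j < i).
  transitivity #|pred1 j|; last by rewrite card1.
  apply: eq_card => l; rewrite !inE.
  apply/idP/eqP => [/andP[/andP[_ /eqP]]|->].
    by rewrite /color; case: ifP => // _ [].
  by rewrite ji /ups /= color_single // eqxx !andbT; apply: contraTneq sj => ->.
apply: eq_card0 => l; rewrite !inE; apply/negP => /andP[/andP[_ /eqP]].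
by rewrite /color; case: ifP => // _ [->]; rewrite ji.
Qed.

Lemma exponent_up j : w j != full -> count_below (ups (color j)) j = exponent j.
Proof.
move=> wj; rewrite /exponent; case: (boolP (is_single (w j))) => sj.
  by rewrite color_single // ups_single // downs_single ltnn.
rewrite color_empty // ups_downs_level //; last exact: ltnW.
  by rewrite ltnn addn0.
by case/andP: (height_strip j).
Qed.

Lemma height_full j : w j == full -> 1 < height j.
Proof.
move=> /eqP wj; have := height_strip j.+1; rewrite heightS wj /=; lia.
Qed.

Lemma exponent_down j : w j == full -> count_below (ups (color j)) j = (exponent j).+1.
Proof.
move=> wj; have h1 := height_full wj.
rewrite /exponent (color_full wj) ups_downs_level; [|lia|exact: ltnW].
by rewrite prednK ?leqnn ?addn1 //; lia.
Qed.

Lemma exponent_inj i j : color i = color j -> exponent i = exponent j ->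
  (w i == full) = (w j == full) -> i = j.
Proof.
move=> cij pij; case: (boolP (w i == full)) => wi /esym wj.
  apply: (@count_below_inj _ (downs (color j))); rewrite /downs /= ?wi ?wj ?cij ?eqxx //.
  by move: pij; rewrite /exponent cij.
apply: (@count_below_inj _ (ups (color j))); rewrite /ups /= ?wi ?wj ?cij ?eqxx //.
by rewrite -{1}cij !exponent_up ?wj.
Qed.

Lemma partner_before j : w j == full ->
  exists j', [/\ w j' != full, color j' = color j, exponent j' = exponent j & j' < j].
Proof.
move=> wj; have [|j' [/andP[wj' /eqP cj'] lt e]] :=
  @count_below_nth m (ups (color j)) j (exponent j) (ltnW (ltn_ord j)).
  by rewrite exponent_down.
by exists j'; split=> //; rewrite -e -cj' exponent_up.
Qed.

(** A strip word ends above all its tracks, so every track ends with an up. *)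
Lemma partner_after j : w j == full ->
  exists j', [/\ w j' != full, color j' = color j & exponent j' = (exponent j).+1].
Proof.
move=> wj; have [|j' [/andP[wj' /eqP cj'] lt e]] :=
  @count_below_nth m (ups (color j)) m (exponent j).+1 (leqnn m).
  have h1 := height_full wj; have hj := height_strip j.
  have : exponent j < count_below (downs (color j)) m.
    apply: leq_trans (count_below_le _ (ltn_ord j)).
    by rewrite count_belowS /downs /= wj eqxx addn1.
  rewrite (color_full wj) ups_downs_level; [|lia|exact: leqnn].
  rewrite height_last (_ : (height j).-1 < L.-1); last lia.
  by rewrite addn1.
by exists j'; split=> //; rewrite -e -cj' exponent_up.
Qed.

(** The exponent counts ups as well as downs; this is the form in which the
rearrangement inequality uses it. *)
Lemma exponent_ups j : (exponent j).+1 = #|[pred l : 'I_m | ups (color j) l & l <= j]|.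
Proof.
transitivity (count_below (ups (color j)) j.+1) => //.
rewrite count_belowS /ups /= eqxx andbT; case: (boolP (w j == full)) => wj.
  by rewrite exponent_down // addn0.
by rewrite exponent_up // addn1.
Qed.
End Tracks.

Local Open Scope ring_scope.

(** * The reflection formula *)

Fixpoint free_walks (N : nat) (y : int) : int :=
  if N is N'.+1 then free_walks N' (y - 1) + free_walks N' (y + 1)
  else (y == 0)%:R.

Lemma free_walks_far N y : N%:Z < `|y| -> free_walks N y = 0.
Proof.
elim: N y => [|N IH] y /= h; first by case: eqP => // E; lia.
by rewrite !IH ?addr0 //; lia.
Qed.

Lemma free_walksN N y : free_walks N (- y) = free_walks N y.
Proof.
elim: N y => [|N IH] y /=; first by rewrite oppr_eq0.
have -> : - y - 1 = - (y + 1) by ring.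
have -> : - y + 1 = - (y - 1) by ring.
by rewrite !IH addrC.
Qed.

Lemma binzS n b : binz n.+1 b = binz n b + binz n (b - 1).
Proof.
case: b => [[|b]|b].
- by rewrite /= !bin0.
- have -> : Posz b.+1 - 1 = b by lia.
  by rewrite /= binS PoszD.
- by have -> : Negz b - 1 = Negz b.+1 by lia.
Qed.

Lemma free_walks_binz N b : free_walks N (N%:Z - 2 * b) = binz N b.
Proof.
elim: N b => [|N IH] b.
  by case: b => [[|b]|b] //=; case: eqP => // E; exfalso; lia.
rewrite /= binzS -!IH; congr (free_walks _ _ + free_walks _ _); lia.
Qed.

Section Reflection.
Variables (d e : int) (J : nat).

(** The alternating sum over the images of the end point e in the barriers 0 and
d, truncated to the translations by 2 j d with - J.+1 <= j <= J. *)
Definition reflected_walks N (x : int) : int :=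
  \sum_(0 <= j < J.+1)
    (free_walks N (e - x + 2 * j%:Z * d) - free_walks N (e + x + 2 * j%:Z * d)
     + (free_walks N (e - x - 2 * j.+1%:Z * d)
        - free_walks N (e + x - 2 * j.+1%:Z * d))).

Lemma reflected_walks0 N : reflected_walks N 0 = 0.
Proof. by rewrite /reflected_walks big1 // => j _; rewrite !(subr0, addr0, subrr). Qed.

Lemma reflected_walksS N x :
  reflected_walks N.+1 x = reflected_walks N (x + 1) + reflected_walks N (x - 1).
Proof.
rewrite /reflected_walks -big_split /=; apply: eq_bigr => j _.
have E1 t : e - x + t - 1 = e - (x + 1) + t by ring.
have E2 t : e - x + t + 1 = e - (x - 1) + t by ring.
have E3 t : e + x + t - 1 = e + (x - 1) + t by ring.
have E4 t : e + x + t + 1 = e + (x + 1) + t by ring.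
by rewrite !E1 !E2 !E3 !E4; ring.
Qed.

(** At the barrier d the images cancel in pairs, up to the two extreme ones, which
are out of reach in N steps. *)
Lemma reflected_walks_top N : d - 2 <= e < d -> N%:Z + 2 < 2 * J.+1%:Z * d ->
  reflected_walks N d = 0.
Proof.
move=> ed hN; rewrite /reflected_walks big_split /= !sumrB.
pose A (j : nat) := free_walks N (e - d + 2 * j%:Z * d).
pose B (j : nat) := free_walks N (e - d - 2 * j%:Z * d).
rewrite -/A.
have -> : \sum_(0 <= j < J.+1) free_walks N (e + d + 2 * j%:Z * d) = \sum_(0 <= j < J.+1) A j.+1.
  by apply: eq_bigr => j _; rewrite /A; congr free_walks; rewrite -[j.+1]addn1 PoszD; ring.
have -> : \sum_(0 <= j < J.+1) free_walks N (e + d - 2 * j.+1%:Z * d) = \sum_(0 <= j < J.+1) B j.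
  by apply: eq_bigr => j _; rewrite /B; congr free_walks; rewrite -[j.+1]addn1 PoszD; ring.
rewrite -!sumrB.
have -> : \sum_(0 <= j < J.+1) (A j - A j.+1) = A 0%N - A J.+1.
  rewrite -opprB -telescope_sumr // -sumrN; apply: eq_bigr => j _; ring.
rewrite (telescope_sumr B) //.
have -> : A J.+1 = 0 by apply: free_walks_far; lia.
have -> : B J.+1 = 0 by apply: free_walks_far; lia.
by rewrite /A /B !mulr0 !mul0r addr0 subr0; ring.
Qed.

Lemma reflected_walks_base x : 0 < x < d -> 0 < e < d ->
  reflected_walks 0 x = (x == e)%:R.
Proof.
move=> xd ed; rewrite /reflected_walks big_nat_recl //= big1 => [|j _].
  by do !(case: eqP => ?) => //=; exfalso; nia.
by do !(case: eqP => ?) => //=; exfalso; nia.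
Qed.

End Reflection.

Lemma strip_walks_reflected (w e J N x : nat) :
  (w.-1 <= e <= w)%N -> (x <= w)%N -> N%:Z + 2 < 2 * J.+1%:Z * (w%:Z + 2) ->
  (strip_walks w e N x)%:Z = reflected_walks (w%:Z + 2) (e%:Z + 1) J N (x%:Z + 1).
Proof.
move=> ew; elim: N x => [|N IH] x xw hN.
  rewrite reflected_walks_base; [|lia|lia].
  by rewrite /= (inj_eq (addIr 1)) eqz_nat; case: eqP.
rewrite reflected_walksS /= PoszD; congr (_ + _).
  case: ltngtP xw => // [xw|->] _.
    by rewrite IH //; last lia; congr reflected_walks; lia.
  have -> : w%:Z + 1 + 1 = w%:Z + 2 by lia.
  by rewrite reflected_walks_top //; lia.
case: x xw => [|x] xw /=; first by rewrite subrr reflected_walks0.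
by rewrite IH; [congr reflected_walks; lia|lia|lia].
Qed.

Lemma lattice_c_formula (n s : nat) : ~~ odd n -> (s <= n./2)%N ->
  let delta : int := n%:Z - 2 * s%:Z + 4 in
  (lattice_c n s)%:Z =
  \sum_(0 <= j < ((s + 2) %/ 3).+1)
    (binz n (s%:Z - j%:Z * delta)
     - 2 * binz n (s%:Z - 2 - j%:Z * delta)
     + binz n (s%:Z - 4 - j%:Z * delta)).
Proof.
move=> nE sn delta; rewrite lattice_c_walks //.
have hs : (s <= 3 * ((s + 2) %/ 3))%N by lia.
rewrite (@strip_walks_reflected _ _ ((s + 2) %/ 3)); [|lia|lia|nia].
rewrite /reflected_walks; apply: eq_bigr => j _.
have -> : (n + 2 - 2 * s)%N%:Z + 2 = delta by rewrite /delta; lia.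
have -> : (n + 1 - 2 * s)%N%:Z + 1 = delta - 2 by rewrite /delta; lia.
have -> : delta - 2 - (1%N%:Z + 1) + 2 * j%:Z * delta = n%:Z - 2 * (s%:Z - j%:Z * delta).
  by rewrite {1}/delta; ring.
have -> : delta - 2 + (1%N%:Z + 1) + 2 * j%:Z * delta = n%:Z - 2 * (s%:Z - 2 - j%:Z * delta).
  by rewrite {1}/delta; ring.
have -> : delta - 2 - (1%N%:Z + 1) - 2 * j.+1%:Z * delta = - (n%:Z - 2 * (s%:Z - 4 - j%:Z * delta)).
  by rewrite -[j.+1]addn1 PoszD /delta; ring.
have -> : delta - 2 + (1%N%:Z + 1) - 2 * j.+1%:Z * delta = - (n%:Z - 2 * (s%:Z - 2 - j%:Z * delta)).
  by rewrite -[j.+1]addn1 PoszD /delta; ring.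
rewrite !free_walksN !free_walks_binz; ring.
Qed.

(** * Genericity in one parameter *)

Section Avoid.
Variable k : fieldType.
Hypothesis char0 : [pchar k] =i pred0.

Lemma natr_eq0_char0 n : (n%:R == 0 :> k) = (n == 0)%N.
Proof. exact: (pcharf0P k).1. Qed.

(** In characteristic 0 the images of the natural numbers are distinct, hence more
numerous than the roots. *)
Lemma nonroot_exists (p : {poly k}) : p != 0 -> exists x : k, p.[x] != 0.
Proof.
move=> p0; pose s : seq k := [seq i%:R | i <- iota 0 (size p)].
have us : uniq s.
  rewrite map_inj_in_uniq ?iota_uniq // => i j _ _ /eqP.
  wlog ij : i j / (i <= j)%N => [H|].
    by case/orP: (leq_total i j) => ij; [|rewrite eq_sym]; move/(H _ _ ij).
  rewrite eq_sym -subr_eq0 -natrB // natr_eq0_char0 subn_eq0 => ji.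
  by apply/eqP; rewrite eqn_leq ij.
case: (boolP (all (root p) s)) => [/(max_poly_roots p0)/(_ us)|/allPn[x _ nx]].
  by rewrite size_map size_iota ltnn.
by exists x.
Qed.
End Avoid.

Section Pencil.
Variables (k : fieldType) (V W : vectType k).

(** With C a right inverse of the matrix A of f0, the determinant of (A + x B) C is
a polynomial in x that takes the value 1 at 0. *)
Lemma pencil_injective (f0 f1 : V -> W) : linear f0 -> linear f1 ->
  (forall v, f0 v = 0 -> v = 0) ->
  exists2 p : {poly k}, p != 0 &
    forall x, p.[x] != 0 -> forall v, f0 v + x *: f1 v = 0 -> v = 0.
Proof.
move=> lin0 lin1 inj0.
pose F0 : {linear V -> W} := HB.pack f0 (GRing.isLinear.Build _ _ _ _ f0 lin0).
pose F1 : {linear V -> W} := HB.pack f1 (GRing.isLinear.Build _ _ _ _ f1 lin1).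
pose A := lin1_mx (v2r \o F0 \o r2v); pose B := lin1_mx (v2r \o F1 \o r2v).
have AE v : v2r v *m A = v2r (f0 v) by rewrite mul_rV_lin1 /= v2rK.
have BE v : v2r v *m B = v2r (f1 v) by rewrite mul_rV_lin1 /= v2rK.
have /row_freeP[C AC] : row_free A.
  apply: inj_row_free => u uA; apply: (can_inj r2vK); rewrite [RHS]linear0.
  by apply: inj0; apply: v2r_inj; rewrite linear0 -AE r2vK.
pose M : 'M[{poly k}]_(dim V) := 1%:M + 'X *: map_mx polyC (B *m C).
have ME x : (\det M).[x] = \det (1%:M + x *: (B *m C)).
  rewrite -[LHS]/(horner_eval x _) -det_map_mx; congr (\det _).
  apply/matrixP => i j; rewrite !mxE /= /horner_eval hornerD hornerM hornerX hornerC.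
  by rewrite -polyC_natr hornerC.
exists (\det M).
  by apply/eqP => /(congr1 (fun q => q.[0])); rewrite ME scale0r addr0 det1 horner0 => /eqP; rewrite oner_eq0.
move=> x; rewrite ME -unitfE -unitmxE => Mu v fv0.
have: v2r v *m (1%:M + x *: (B *m C)) = 0.
  rewrite mulmxDr mulmx1 -scalemxAr mulmxA BE -{1}[v2r v]mulmx1 -AC mulmxA AE.
  by rewrite scalemxAl -mulmxDl -linearZ -linearD fv0 linear0 mul0mx.
move/(congr1 (mulmxr (invmx (1%:M + x *: (B *m C))))) => /=; rewrite mul0mx mulmxK //.
by rewrite -[0](linear0 v2r) => /v2r_inj.
Qed.
End Pencil.

(** * Upper bound: functions determined by their values on strip words *)

Definition fill m (w : word m) (i : 'I_m) : word m :=
  [ffun j => if j == i then full else w j].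

Definition wdeg m (w : word m) : nat := (\sum_i ((w i).1 + (w i).2))%N.

Lemma fill_consw0 m c (w : word m) : fill (consw c w) ord0 = consw full w.
Proof.
apply/ffunP => j; rewrite !ffunE.
by case: unliftP => [i|] ->; rewrite ?eqxx // (negPf (neq_lift _ _)) // eq_sym.
Qed.

Lemma fill_conswS m c (w : word m) i : fill (consw c w) (lift ord0 i) = consw c (fill w i).
Proof.
apply/ffunP => j; rewrite !ffunE.
case: unliftP => [l|] ->; last by rewrite (negPf (neq_lift _ _)).
by rewrite ffunE (inj_eq lift_inj).
Qed.

Lemma wdeg_consw m c (w : word m) : wdeg (consw c w) = (c.1 + c.2 + wdeg w)%N.
Proof.
rewrite /wdeg big_ord_recl consw0; congr (_ + _)%N.
by apply: eq_bigr => i _; rewrite conswS.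
Qed.

Lemma strip_consw L a m c (w : word m) :
  strip_word L a (consw c w) = (0 < a < L)%N && strip_word L (word_step a c) w.
Proof. by rewrite /strip_word codom_consw. Qed.

Section Contraction.
Variable k : fieldType.
Implicit Types (m b : nat) (c : letter).

Local Notation wfun m := {ffun word m -> k^o}.

(** The transpose, in the basis of words, of the product by sum_i lam_i z_i. *)
Definition contract m (lam : 'I_m -> k) (phi : wfun m) : wfun m :=
  [ffun w : word m => (\sum_(i | w i == empty) lam i * phi (fill w i)) : k^o].

Definition slice m c (phi : wfun m.+1) : wfun m := [ffun w : word m => phi (consw c w)].

Lemma contract_linear m (lam : 'I_m -> k) : linear (contract lam).
Proof.
move=> a u v; apply/ffunP => w; rewrite !ffunE /= /GRing.scale /= mulr_sumr -big_split.
by apply: eq_bigr => i _; rewrite !ffunE /GRing.scale /=; ring.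
Qed.
HB.instance Definition _ m lam :=
  GRing.isLinear.Build k (wfun m) (wfun m) _ (contract lam) (contract_linear lam).

Lemma slice_linear m c : linear (@slice m c).
Proof. by move=> a u v; apply/ffunP => w; rewrite !ffunE. Qed.
HB.instance Definition _ m c :=
  GRing.isLinear.Build k (wfun m.+1) (wfun m) _ (@slice m c) (@slice_linear m c).

Lemma slice_inj m (phi : wfun m.+1) : (forall c, slice c phi = 0) -> phi = 0.
Proof.
move=> h; apply/ffunP => w; rewrite -(tailwK w).
by have /ffunP/(_ (tailw w)) := h (w ord0); rewrite !ffunE.
Qed.

Lemma slice_contract m c (lam : 'I_m.+1 -> k) (phi : wfun m.+1) :
  slice c (contract lam phi) = contract (lam \o lift ord0) (slice c phi) +
    (if c == empty then lam ord0 *: slice full phi else 0).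
Proof.
apply/ffunP => w; rewrite !ffunE big_mkcond big_ord_recl consw0 [LHS]addrC.
congr (_ + _).
  rewrite [RHS]big_mkcond; apply: eq_bigr => i _ /=.
  by rewrite conswS fill_conswS ffunE.
by rewrite fill_consw0; case: ifP => _; rewrite !ffunE.
Qed.

(** The binomial formula for (D + lam_0 d_0) ^ b, where the derivation d_0 has
square zero. *)
Lemma slice_iter_contract m b c (lam : 'I_m.+1 -> k) (phi : wfun m.+1) :
  slice c (iter b (contract lam) phi) = iter b (contract (lam \o lift ord0)) (slice c phi) +
    (if c == empty then (b%:R * lam ord0) *: iter b.-1 (contract (lam \o lift ord0)) (slice full phi)
     else 0).
Proof.
elim: b c => [|b IH] c; first by rewrite mul0r scale0r if_same addr0.
rewrite /= slice_contract IH linearD -addrA; congr (_ + _).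
case: (c == empty); last by rewrite linear0 addr0.
rewrite linearZ IH /= addr0 -[b.+1]addn1 natrD mulrDl mul1r scalerDl; congr (_ + _).
by case: b {IH} => [|b] //=; rewrite mul0r !scale0r.
Qed.

Hypothesis char0 : [pchar k] =i pred0.

Lemma slice_supp m c (phi : wfun m.+1) (P : nat -> Prop) :
  (forall w, phi w != 0 -> P (wdeg w)) ->
  forall w, slice c phi w != 0 -> P (c.1 + c.2 + wdeg w)%N.
Proof. by move=> h w; rewrite ffunE => /h; rewrite wdeg_consw. Qed.

(** The Lefschetz property.  On the slice where the first letter is empty the
exponent b becomes b + 1, on the slice where it is full b - 1, in accordance with
the degree bound m + b. *)
Lemma iter_contract_injective m (lam : 'I_m -> k) b (phi : wfun m) :
  (forall i, lam i != 0) -> (forall w, phi w != 0 -> (m + b <= wdeg w)%N) ->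
  iter b (contract lam) phi = 0 -> phi = 0.
Proof.
elim: m lam b phi => [|m IH] lam b phi lam0 supp.
  case: b supp => // b supp _; apply/ffunP => w; rewrite ffunE.
  by apply/eqP/negPn/negP => /supp; rewrite /wdeg big_ord0.
case: b supp => // b supp h0.
have lam'0 i : (lam \o lift ord0) i != 0 by apply: lam0.
have S c := @slice_supp m c phi (fun d => m.+1 + b.+1 <= d)%N supp.
have E c : 0 = iter b.+1 (contract (lam \o lift ord0)) (slice c phi) +
    (if c == empty then (b.+1%:R * lam ord0) *:
       iter b (contract (lam \o lift ord0)) (slice full phi) else 0).
  by rewrite -(slice_iter_contract b.+1) h0 linear0.
have Efull := E full; rewrite /= addr0 in Efull.
have Eempty := E empty; rewrite eqxx in Eempty.
have s0 : slice empty phi = 0.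
  apply: (IH _ b.+2 _ lam'0) => [w /S /=|]; first by lia.
  have := congr1 (contract (lam \o lift ord0)) Eempty.
  by rewrite linear0 linearD linearZ /= -[contract _ (iter b _ _)]/(iter b.+1 _ _) -Efull scaler0 addr0.
have s2 : slice full phi = 0.
  apply: (IH _ b _ lam'0) => [w /S /=|]; first by lia.
  move/esym/eqP: Eempty; rewrite s0.
  have -> : iter b.+1 (contract (lam \o lift ord0)) 0 = 0.
    by move: (b.+1) => b'; elim: b' => //= b' ->; rewrite linear0.
  by rewrite add0r scaler_eq0 mulf_eq0 (negPf (lam0 _)) natr_eq0_char0 //= => /eqP.
apply: slice_inj => -[[] []] //.
  apply: (IH _ b.+1 _ lam'0) => [w /S /=|]; first by lia.
  by have := E (true, false); rewrite addr0.
apply: (IH _ b.+1 _ lam'0) => [w /S /=|]; first by lia.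
by have := E (false, true); rewrite addr0.
Qed.

(** The solutions phi of degree a + 1 + m - L that vanish on the strip words are
zero.  With L as parameter in place of the degree, the statement keeps its L when
a letter is removed, as the walk keeps its strip. *)
Definition strip_determined m (lam : 'I_m -> k) (a L : nat) := forall phi : wfun m,
  (forall w, phi w != 0 -> (wdeg w + L = a + 1 + m)%N) ->
  (forall w, strip_word L a w -> phi w = 0) ->
  iter a (contract (fun=> 1)) phi = 0 -> contract lam phi = 0 -> phi = 0.

Definition cons_lam m (x : k) (lam : 'I_m -> k) (i : 'I_m.+1) : k :=
  if unlift ord0 i is Some j then lam j else x.

Lemma cons_lam_lift m x (lam : 'I_m -> k) : cons_lam x lam \o lift ord0 =1 lam.
Proof. by move=> i; rewrite /= /cons_lam liftK. Qed.

Lemma eq_contract m (lam lam' : 'I_m -> k) : lam =1 lam' -> contract lam =1 contract lam'.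
Proof. by move=> h phi; apply/ffunP => w; rewrite !ffunE; apply: eq_bigr => i _; rewrite h. Qed.

(** When the first weight is 0, the slices of a solution are solutions for the
height after the first letter: a + 1 for the empty letter, a for the flat ones
and, once the empty slice is known to vanish, a - 1 for the full one. *)
Lemma strip_determined_at_zero m (lam : 'I_m -> k) a L :
  strip_determined lam a.+1 L -> strip_determined lam a L -> strip_determined lam a.-1 L ->
  (0 < a < L)%N -> strip_determined (cons_lam 0 lam) a L.
Proof.
move=> dS d0 dP aL phi supp strip hX hY.
have S c := @slice_supp m c phi (fun d => d + L = a + 1 + m.+1)%N supp.
have T c w : strip_word L (word_step a c) w -> slice c phi w = 0.
  by move=> sw; rewrite ffunE; apply: strip; rewrite strip_consw aL.
have Y c : contract lam (slice c phi) = 0.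
  have := slice_contract c (cons_lam 0 lam) phi.
  rewrite hY linear0 (eq_contract (cons_lam_lift _ _)) /cons_lam unlift_none.
  by rewrite scale0r if_same addr0.
have X c : 0 = iter a (contract (fun=> 1)) (slice c phi) +
    (if c == empty then a%:R *: iter a.-1 (contract (fun=> 1)) (slice full phi) else 0).
  by have := slice_iter_contract a c (fun=> 1) phi; rewrite hX linear0 mulr1.
have Xfull := X full; rewrite /= addr0 in Xfull.
have Xempty := X empty; rewrite eqxx in Xempty.
have s0 : slice empty phi = 0.
  apply: dS => //; [by move=> w /S /=; lia | exact: (T empty) |].
  have := congr1 (contract (fun=> 1)) Xempty.
  rewrite linear0 linearD linearZ /= -[contract _ (iter a.-1 _ _)]/(iter a.-1.+1 _ _).
  by rewrite prednK -?Xfull ?scaler0 ?addr0 //; case/andP: aL.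
have s2 : slice full phi = 0.
  apply: dP => //; [by move=> w /S /=; lia | exact: (T full) |].
  move/esym/eqP: Xempty; rewrite s0.
  have -> : iter a (contract (fun=> 1)) 0 = 0 :> wfun m.
    by move: (a) => b'; elim: b' => //= b' ->; rewrite linear0.
  rewrite add0r scaler_eq0 natr_eq0_char0 //= => /orP[|/eqP //]; lia.
apply: slice_inj => -[[] []] //; apply: d0 => //.
- by move=> w /S /=; lia.
- exact: (T (true, false)).
- by have := X (true, false); rewrite addr0.
- by move=> w /S /=; lia.
- exact: (T (false, true)).
- by have := X (false, true); rewrite addr0.
Qed.

Lemma strip_determined_generic m (lam : 'I_m -> k) a L :
  (0 < a < L)%N -> strip_determined (cons_lam 0 lam) a L ->
  exists2 p : {poly k}, p != 0 &
    forall x, p.[x] != 0 -> strip_determined (cons_lam x lam) a L.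
Proof.
move=> aL d0.
(* Both conditions on the values of phi, support and strip words, in one linear map. *)
pose mask (phi : wfun m.+1) : wfun m.+1 :=
  [ffun w : word m.+1 => if (wdeg w + L == a + 1 + m.+1)%N && ~~ strip_word L a w then 0 else phi w : k^o].
have mask_lin : linear mask.
  move=> t u v; apply/ffunP => w; rewrite !ffunE; case: ifP => // _.
  by rewrite scaler0 addr0.
have iter_lin b : linear (iter b (@contract m.+1 (fun=> 1))).
  by move=> t u v; elim: b => //= b ->; rewrite linearP.
pose f0 phi := (contract (cons_lam 0 lam) phi, iter a (contract (fun=> 1)) phi, mask phi).
pose f1 phi : wfun m.+1 * wfun m.+1 * wfun m.+1 :=
  (contract (cons_lam 1 (fun=> 0)) phi, 0, 0).
have [] := @pencil_injective k (wfun m.+1) (wfun m.+1 * wfun m.+1 * wfun m.+1)%type f0 f1.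
- by move=> t u v; rewrite /f0 linearP iter_lin mask_lin.
- move=> t u v; have e0 : 0 = t *: 0 + 0 :> wfun m.+1 by rewrite scaler0 addr0.
  by rewrite /f1 linearP; congr (_, _, _); exact: e0.
- move=> phi [hY hX hm]; apply: d0 => // w hw.
    apply/eqP/negPn/negP => ne; move/ffunP/(_ w): hm; rewrite !ffunE.
    by by rewrite (negPf ne) /= => E; rewrite E eqxx in hw.
  by move/ffunP/(_ w): hm; rewrite !ffunE hw andbF.
move=> p p0 hp; exists p => // x /hp{}hp phi supp strip hX hY; apply: hp.
congr (_, _, _) => /=; rewrite ?scaler0 ?addr0 //.
  rewrite -hY; apply/ffunP => w; rewrite !ffunE /GRing.scale /= mulr_sumr -big_split /=.
  apply: eq_bigr => i _; rewrite /cons_lam; case: unlift => [j|]; ring.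
apply/ffunP => w; rewrite !ffunE; case: ifP => // /negbT.
rewrite negb_and negbK => /orP[nd|/strip //].
by apply/eqP/negPn/negP => /supp/eqP; rewrite (negPf nd).
Qed.

(** The weights are found one at a time, each generic with respect to the previous
ones.  The bound N on a, which the induction decreases, leaves finitely many
conditions on each weight. *)
Lemma strip_determined_exists m N : exists lam : 'I_m -> k,
  forall a L, (a <= N)%N -> strip_determined lam a L.
Proof.
suff [lam [_ h]] : exists lam : 'I_m -> k,
  (forall i, lam i != 0) /\ forall a L, (a <= N)%N -> strip_determined lam a L by exists lam.
elim: m N => [|m IH] N.
  exists (fun=> 0); split=> [[]//|] a L _ phi supp strip hX hY.
  apply/ffunP => w; rewrite [RHS]ffunE; apply/eqP/negPn/negP => nz.
  have := supp _ nz; rewrite /wdeg big_ord0 => aL.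
  case: (posnP a) => [a0|a0]; first by rewrite a0 /= in hX; rewrite hX ffunE eqxx in nz.
  case/eqP: nz; apply: strip; rewrite /strip_word /codom /image_mem enum_ord0 /=; lia.
have [lam [lam0 det]] := IH N.+1.
pose good (a L : nat) (p : {poly k}) := p != 0 /\
  (forall x, p.[x] != 0 -> (0 < a < L)%N -> strip_determined (cons_lam x lam) a L).
have ex a L : exists p, (a <= N)%N -> good a L p.
  case: (leqP a N) => aN; last by exists 0.
  case: (boolP (0 < a < L)%N) => aL.
    have [|p p0 hp] := @strip_determined_generic _ lam a L aL.
      by apply: strip_determined_at_zero => //; apply: det; lia.
    by exists p => _; split=> // x /hp.
  by exists 1 => _; split=> [|x _]; rewrite ?oner_eq0 // (negPf aL).
have {ex} /fin_all_exists[P hP] : forall aL : 'I_N.+1 * 'I_(N + m).+3, exists p, good aL.1 aL.2 p.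
  by case=> a L; have [p hp] := ex a L; exists p; apply: hp; rewrite -ltnS.
have p0 : 'X * \prod_aL P aL != 0.
  rewrite mulf_neq0 ?polyX_eq0 //; apply/prodf_neq0 => aL _; exact: (hP aL).1.
have [x] := nonroot_exists char0 p0.
rewrite hornerM hornerX mulf_eq0 negb_or horner_prod => /andP[x0 /prodf_neq0 hx].
exists (cons_lam x lam).
have lamx0 i : cons_lam x lam i != 0 by rewrite /cons_lam; case: unlift.
split=> // a L aN phi supp strip hX hY.
case: (posnP a) => [a0|a0]; first by rewrite a0 in hX.
case: (leqP L a) => La.
  by apply: (@iter_contract_injective _ _ 1 _ lamx0) => // w /supp; lia.
case: (ltnP L (N + m).+3) => LN; last first.
  apply/ffunP => w; rewrite [RHS]ffunE; apply/eqP/negPn/negP => /supp; lia.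
have aN' : (a < N.+1)%N by [].
have := (hP (Ordinal aN', Ordinal LN)).2 x (hx _ isT).
by rewrite /= a0 La => /(_ isT); apply.
Qed.
End Contraction.

(** * Lower bound: one determinant for each strip word *)

(** The derivative of det (A (1 + t N)) at t = 0, computed row by row. *)
Lemma det_derivation (R : comNzRingType) n (A N : 'M[R]_n) :
  \sum_i \det (\matrix_(a, b) if a == i then (A *m N) a b else A a b) = \tr N * \det A.
Proof.
transitivity (\tr (A *m N *m \adj A)).
  apply: eq_bigr => i _; rewrite (expand_det_row _ i) [RHS]mxE.
  apply: eq_bigr => j _; rewrite !mxE eqxx; congr (_ * _).
  rewrite /cofactor; congr (_ * \det _); apply/matrixP => a b; rewrite !mxE.
  by rewrite eq_sym (negPf (neq_lift _ _)).
by rewrite mxtrace_mulC mulmxA mul_adj_mx mul_scalar_mx mxtraceZ mulrC.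
Qed.

(** For a permutation s that preserves the tracks, sum_i i * exponent (s i) is
largest when s preserves the exponents.  Since exponents count ups, this sum is,
up to a quantity that does not depend on s, half the sum over i of [total i (s i)],
and [total i j] collects all the positive terms 2 (i - l) + 1 exactly when the ups
l <= j are the ups l <= i. *)
Section Rearrangement.
Variables (m L : nat) (w : word m).
Hypothesis wL : strip_word L 1 w.

Let term (i j : 'I_m) (l : 'I_m) : int :=
  if (l <= j)%N then 2 * i%:Z - 2 * l%:Z + 1 else 0.
Let total (i j : 'I_m) : int := \sum_(l | ups w (color w i) l) term i j l.

Let term_le i j l : term i j l <= term i i l.
Proof. by rewrite /term; case: (leqP l j) => h1; case: (leqP l i) => h2 //; lia. Qed.

Let total_le i j : total i j <= total i i.
Proof. exact: ler_sum. Qed.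

Let total_eq i j : color w j = color w i -> total i j = total i i -> exponent w j = exponent w i.
Proof.
move=> cij tij.
have H : total i j <= total i i ?= iff
    [forall (l | ups w (color w i) l), term i j l == term i i l].
  by apply: leif_sum => l _; apply: leif_eq; apply: term_le.
move: (eq_leif H); rewrite tij eqxx => /esym/forall_inP E.
apply: succn_inj; rewrite !(exponent_ups wL) cij; apply: eq_card => l; rewrite !inE.
case u: (ups w (color w i) l) => //=.
move: (E l u); rewrite /term; case: (leqP l j) => h1; case: (leqP l i) => h2 //= /eqP; lia.
Qed.

Let shift (j : 'I_m) : int := \sum_(l | ups w (color w j) l && (l <= j)%N) 2 * l%:Z.

Let totalE i j : color w j = color w i ->
  total i j = (2 * i%:Z + 1) * (exponent w j).+1%:Z - shift j.
Proof.
move=> cij; rewrite /total -big_mkcondr /= (exponent_ups wL) /shift cij.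
have -> : (2 * i%:Z + 1) * #|[pred l | ups w (color w i) l & (l <= j)%N]|%:Z =
   \sum_(l | ups w (color w i) l && (l <= j)%N) (2 * i%:Z + 1).
  by rewrite -[#|_|%:Z]natz mulr_natr -sumr_const.
by rewrite -sumrB; apply: eq_bigr => l _; ring.
Qed.

Lemma exponent_rearrangement (s : {perm 'I_m}) :
  (forall i, color w (s i) = color w i) ->
  (\sum_(i < m) i * exponent w (s i) <= \sum_(i < m) i * exponent w i)%N /\
  ((\sum_(i < m) i * exponent w (s i) = \sum_(i < m) i * exponent w i)%N ->
   forall i, exponent w (s i) = exponent w i).
Proof.
move=> cs.
have H : \sum_i total i (s i) <= \sum_i total i i ?= iff
    [forall (i | true), total i (s i) == total i i].
  by apply: leif_sum => i _; apply: leif_eq; apply: total_le.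
have re (F : 'I_m -> int) : \sum_i F (s i) = \sum_i F i.
  by rewrite [RHS](reindex_inj (@perm_inj _ s)).
have E t : (forall i, color w (t i) = color w i) -> \sum_i total i (t i) =
    2 * (\sum_(i < m) i * exponent w (t i))%N%:Z + \sum_i (exponent w (t i))%:Z
    + (\sum_(i < m) (2 * i%:Z + 1) - \sum_i shift (t i)).
  move=> ct; rewrite (big_morph Posz PoszD (erefl _)) mulr_sumr -sumrB -!big_split /=.
  by apply: eq_bigr => i _; rewrite totalE // -[(exponent _ _).+1]addn1 PoszD PoszM; ring.
have {}E : \sum_i total i i - \sum_i total i (s i) =
  2 * ((\sum_(i < m) i * exponent w i)%N%:Z - (\sum_(i < m) i * exponent w (s i))%N%:Z).
  by rewrite (E id) // (E s) //= (re (fun i => (exponent w i)%:Z)) (re shift); ring.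
have le : 0 <= \sum_i total i i - \sum_i total i (s i) by rewrite subr_ge0; exact: leif_le H.
split; first by rewrite E pmulr_rge0 // subr_ge0 in le.
move=> e i; apply: total_eq => //.
have : \sum_i total i (s i) == \sum_i total i i.
  by rewrite eq_sym -subr_eq0 E e subrr mulr0.
by rewrite (eq_leif H) => /forall_inP/(_ i isT)/eqP.
Qed.
End Rearrangement.

Section TopCoef.
Variable R : comNzRingType.

Lemma coefM_top (p q : {poly R}) a b : (size p <= a.+1)%N -> (size q <= b.+1)%N ->
  (size (p * q)%R <= (a + b).+1)%N /\ (p * q)`_(a + b) = p`_a * q`_b.
Proof.
move=> sp sq; split; first by apply: leq_trans (size_polyMleq _ _) _; lia.
rewrite coefM.
have lta : (a < (a + b).+1)%N by lia.
rewrite (bigD1 (Ordinal lta)) //= addKn big1 ?addr0 // => i.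
rewrite -val_eqE /= => ia; case: (ltnP a i) => h.
  by rewrite [p`_i]nth_default ?mul0r //; apply: leq_trans sp h.
by rewrite [q`_ _]nth_default ?mulr0 //; apply: leq_trans sq _; lia.
Qed.

Lemma coef_prod_top (I : Type) (r : seq I) (F : I -> {poly R}) (d : I -> nat) :
  (forall i, (size (F i) <= (d i).+1)%N) ->
  (size (\prod_(i <- r) F i)%R <= (\sum_(i <- r) d i)%N.+1)%N /\
  (\prod_(i <- r) F i)`_(\sum_(i <- r) d i)%N = \prod_(i <- r) (F i)`_(d i).
Proof.
move=> sF; elim: r => [|i r [IH1 IH2]]; first by rewrite !big_nil size_poly1 coef1.
by rewrite !big_cons; have [h1 h2] := coefM_top (sF i) IH1; rewrite h2 IH2.
Qed.

(** In each product of the Leibniz formula, only the top coefficients of the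
factors reach the total degree. *)
Lemma coef_det_top n (A : 'M[{poly R}]_n) (d : 'I_n -> nat) :
  (forall i j, (size (A i j) <= (d i).+1)%N) ->
  (\det A)`_(\sum_i d i)%N = \det (\matrix_(i, j) (A i j)`_(d i)).
Proof.
move=> sA; rewrite /determinant coef_sum; apply: eq_bigr => s _.
have := (@coef_prod_top _ (index_enum 'I_n) (fun i => A i (s i)) d (fun i => sA i (s i))).2.
set P := \prod_(i <- _) A i (s i); case: (odd_perm s).
  rewrite !expr1 !mulN1r coefN => ->; congr (- _).
  by apply: eq_bigr => i _; rewrite mxE.
by rewrite !expr0 !mul1r => ->; apply: eq_bigr => i _; rewrite mxE.
Qed.
End TopCoef.

Definition same_singles m (w v : word m) : bool :=
  [forall i, (is_single (w i) || is_single (v i)) ==> (w i == v i)].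

Section WalkForm.
Variable R : comNzRingType.

(** Block diagonal along the colors of w.  Row i is the vector of the coefficients
of w_i in the generic row if v i is full, and its constant part otherwise. *)
Definition walk_mx m (w : word m) (lam : 'I_m -> R) (v : word m) : 'M[R]_m :=
  \matrix_(i, j) if (color w i == color w j) && ((v i == full) == (w j == full))
                 then lam i ^+ exponent w j else 0.

Definition walk_form m (w : word m) (lam : 'I_m -> R) (v : word m) : R :=
  if same_singles w v then \det (walk_mx w lam v) else 0.

Lemma same_singles_fill m (w v : word m) i : v i == empty -> same_singles w (fill v i) = same_singles w v.
Proof.
move=> /eqP vi; apply: eq_forallb => j; rewrite ffunE; case: eqP => // ->.
by rewrite vi !orbF; case: (w i) => [[] []].
Qed.

(** Column j of A N below is zero unless w j is full, and is then the column of the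
constant parts of exponent b more.  Hence row i of A N is lam_i ^ b times the row
that replaces row i of A when the letter i is filled, or zero if v i is not empty,
and [det_derivation] applies with trace 0. *)
Lemma walk_form_annihilated m L (w : word m) (lam : 'I_m -> R) (v : word m) (b : bool) :
  strip_word L 1 w ->
  \sum_(i | v i == empty) lam i ^+ b * walk_form w lam (fill v i) = 0.
Proof.
move=> wL; case: (boolP (same_singles w v)) => av; last first.
  rewrite big1 // => i vi; rewrite /walk_form same_singles_fill // (negPf av) mulr0 //.
pose N : 'M[R]_m := \matrix_(j', j)
  if [&& w j' != full, w j == full, color w j' == color w j & exponent w j' == exponent w j + b]%N
  then 1 else 0.
pose A := walk_mx w lam v.
have AN i j : (A *m N) i j =
    if [&& w j == full, color w i == color w j & v i != full]
    then lam i ^+ (exponent w j + b) else 0.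
  rewrite mxE; case: (boolP (w j == full)) => wj /=; last first.
    by rewrite big1 // => j' _; rewrite !mxE (negPf wj) andbF mulr0.
  have [p [wp cp pp]] : exists p,
      [/\ w p != full, color w p = color w j & exponent w p = (exponent w j + b)%N].
    case: b {N} => [|].
      by have [p [? ? ?]] := partner_after wL wj; exists p; rewrite addn1.
    by have [p [? ? ? ?]] := partner_before wL wj; exists p; rewrite addn0.
  rewrite (bigD1 p) //= big1 ?addr0 => [|j' j'p].
    rewrite !mxE wp wj cp pp !eqxx mulr1 (negPf wp).
    by case: (v i == full); rewrite ?andbF.
  rewrite [N _ _]mxE; case: ifP => [/and4P[wj' _ /eqP cj' /eqP pj']|_]; last by rewrite mulr0.
  case/eqP: j'p; apply: (exponent_inj wL); rewrite ?cj' ?cp ?pj' ?pp //.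
  by rewrite (negPf wj') (negPf wp).
have trN : \tr N = 0.
  by rewrite /mxtrace big1 // => i _; rewrite mxE; case: (w i == full).
have := det_derivation A N; rewrite trN mul0r => {2}<-.
rewrite big_mkcond /=; apply: eq_bigr => i _; case: ifP => vi.
  rewrite /walk_form same_singles_fill // av.
  set C := \matrix_(_, _) _.
  rewrite (@determinant_multilinear _ _ C (walk_mx w lam (fill v i)) (walk_mx w lam (fill v i)) i
     (lam i ^+ b) 0) ?mul0r ?addr0 //.
  - apply/rowP => j; rewrite [LHS]mxE [C _ _]mxE eqxx AN !mxE ffunE eqxx (eqP vi) mul0r addr0 eqxx.
    by case: (w j == full); case: (color w i == color w j) => //=; rewrite ?mulr0 // addnC exprD.
  - apply/matrixP => a j; rewrite !mxE ffunE.
    by rewrite ![lift i a == i]eq_sym (negPf (neq_lift _ _)).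
  - apply/matrixP => a j; rewrite !mxE ffunE.
    by rewrite ![lift i a == i]eq_sym (negPf (neq_lift _ _)).
rewrite (expand_det_row _ i) big1 // => j _; rewrite mxE eqxx AN.
case: ifP => [/and3P[wj /eqP cij vif]|_]; last by rewrite mul0r.
have si : is_single (v i) by case: (v i) vi vif => [[] []].
have /forallP/(_ i) := av; rewrite si orbT => /eqP wvi.
rewrite -wvi in si; have e := color_eq_single si cij.
by rewrite e (eqP wj) in si.
Qed.
End WalkForm.

Lemma map_walk_form (R S : comNzRingType) (f : {rmorphism R -> S}) m (w : word m) lam v :
  f (walk_form w lam v) = walk_form w (f \o lam) v.
Proof.
rewrite /walk_form; case: ifP => _; last by rewrite rmorph0.
rewrite -det_map_mx; congr (\det _); apply/matrixP => i j; rewrite !mxE.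
by case: ifP => _; rewrite ?rmorph0 // rmorphXn.
Qed.

Section Independence.
Variable k : fieldType.

Definition top_degree m (w : word m) : nat := (\sum_(i < m) i * exponent w i)%N.
Definition full_sum m (w : word m) : nat := (\sum_(i < m | w i == full) i)%N.

Local Notation formX w v := (walk_form w (fun i => 'X^i : {poly k}) v).

Definition compatible m (w v : word m) (s : {perm 'I_m}) : bool :=
  [forall i, (color w i == color w (s i)) && ((v i == full) == (w (s i) == full))].

(** For lam_i = 'X^i each term of the Leibniz formula is a monomial. *)
Lemma walk_form_expand m (w v : word m) :
  formX w v = if same_singles w v then
    \sum_(s : {perm 'I_m} | compatible w v s) (-1) ^+ s *: 'X^(\sum_(i < m) i * exponent w (s i))
    else 0.
Proof.
rewrite /walk_form; case: ifP => // _; rewrite /determinant [RHS]big_mkcond /=.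
apply: eq_bigr => s _; rewrite -mul_polyC rmorphXn rmorphN rmorph1.
case: ifP => [/forallP cs|/negbT].
  congr (_ * _); rewrite -prodrXr; apply: eq_bigr => i _.
  by rewrite mxE cs -exprM.
rewrite negb_forall => /existsP[i /negPf ni].
by rewrite (bigD1 i) //= mxE ni mul0r mulr0.
Qed.

Variables (m L : nat) (w : word m).
Hypothesis wL : strip_word L 1 w.

Lemma size_walk_form v : (size (formX w v) <= (top_degree w).+1)%N.
Proof.
rewrite walk_form_expand; case: ifP => _; last by rewrite size_poly0.
apply: leq_trans (size_sum _ _ _) _; apply/bigmax_leqP => s /forallP cs.
apply: leq_trans (size_scale_leq _ _) _; rewrite size_polyXn ltnS.
by apply: (exponent_rearrangement wL _).1 => i; have /andP[/eqP-> _] := cs i.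
Qed.

Lemma lead_walk_form v : (formX w v)`_(top_degree w) =
  if same_singles w v then
    \sum_(s : {perm 'I_m} | compatible w v s && [forall i, exponent w (s i) == exponent w i]) (-1) ^+ s
  else 0.
Proof.
rewrite walk_form_expand; case: ifP => _; last by rewrite coef0.
rewrite coef_sum big_mkcondr /=; apply: eq_bigr => s /forallP cs.
rewrite coefZ coefXn eq_sym; case: ifP => [/forallP ps|/negbT np].
  rewrite (_ : (_ == _) = true) ?mulr1 //.
  by apply/eqP; apply: eq_bigr => i _; rewrite (eqP (ps i)).
case: eqP => [e|_]; last by rewrite mulr0.
case/negP: np; apply/forallP => i; apply/eqP; move: i.
by apply: (exponent_rearrangement wL _).2 => // i; have /andP[/eqP-> _] := cs i.
Qed.

Lemma lead_walk_form_diag : (formX w w)`_(top_degree w) = 1.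
Proof.
rewrite lead_walk_form (_ : same_singles w w); last by apply/forallP => i; rewrite eqxx implybT.
rewrite (big_pred1 1%g) ?odd_perm1 // => s /=.
apply/andP/eqP => [[/forallP cs /forallP ps]|->].
  apply/permP => i; rewrite perm1; have /andP[/eqP ci /eqP fi] := cs i.
  by apply: (exponent_inj wL); rewrite ?(eqP (ps i)).
by split; apply/forallP => i; rewrite perm1 !eqxx.
Qed.

(** A permutation that contributes to the leading coefficient preserves color and
exponent, so it fixes i or exchanges it with its partner.  As the down comes after
the up of the same exponent, the full letters of v come before those of w. *)
Lemma lead_walk_form_neq v : (formX w v)`_(top_degree w) != 0 ->
  v = w \/ (full_sum v < full_sum w)%N.
Proof.
rewrite lead_walk_form; case: ifP => [/forallP ag|]; last by rewrite eqxx.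
case: (pickP (fun s : {perm 'I_m} => compatible w v s && [forall i, exponent w (s i) == exponent w i]))
  => [s /andP[/forallP cs /forallP ps] _|none]; last by rewrite big_pred0 ?eqxx.
have le i : v i == full -> (i <= s i)%N.
  move=> vi; have /andP[/eqP ci] := cs i; rewrite vi => /eqP/esym wsi.
  have [p [wp cp pp ps']] := partner_before wL wsi.
  case: (boolP (w i == full)) => wi.
    have -> // : s i = i.
    by apply: (exponent_inj wL); rewrite -?ci ?(eqP (ps i)) ?wi ?wsi.
  have e : i = p.
    by apply: (exponent_inj wL); rewrite ?ci ?cp ?pp ?(eqP (ps i)) // (negPf wi) (negPf wp).
  by rewrite {1}e ltnW.
have E : full_sum w = (\sum_(i < m | v i == full) s i)%N.
  rewrite /full_sum (reindex_inj (@perm_inj _ s)) /=; apply: eq_bigl => i.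
  by have /andP[_ /eqP->] := cs i.
have H : (full_sum v <= full_sum w ?= iff [forall (i | v i == full), i == s i :> nat])%N.
  by rewrite E; apply: leqif_sum => i vi; split=> //; apply: le.
case: (ltngtP (full_sum v) (full_sum w)) => [|h|e]; [by right|by move: H.1; rewrite leqNgt h|].
left; have := H.2; rewrite e eqxx => /esym/forall_inP fixs.
have ff i : (v i == full) = (w i == full).
  have fx j : v j == full -> s j = j by move=> /fixs /eqP h; apply/val_inj.
  apply/idP/idP => [vi|wi].
    by have /andP[_ /eqP] := cs i; rewrite vi fx.
  have := cs (s^-1%g i); rewrite permKV wi => /andP[_ /eqP h].
  by have e' := fx _ h; rewrite permKV in e'; rewrite e'.
apply/ffunP => i; have := ag i; have := ff i.
by case: (v i) (w i) => [[] []] [[] []].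
Qed.
End Independence.

Section Gram.
Variables (m L : nat).

Definition strip_set : {set word m} := [set w | strip_word L 1 w].

Definition walk_gram (R : comNzRingType) (lam : 'I_m -> R) : 'M[R]_#|strip_set| :=
  \matrix_(a, b) walk_form (enum_val a) lam (enum_val b).

Lemma map_walk_gram (R S : comNzRingType) (f : {rmorphism R -> S}) lam :
  map_mx f (walk_gram lam) = walk_gram (f \o lam).
Proof. by apply/matrixP => a b; rewrite !mxE map_walk_form. Qed.

(** The matrix of leading coefficients is triangular with 1 on the diagonal for the
order given by [full_sum]. *)
Lemma det_walk_gram_neq0 (k : fieldType) :
  \det (walk_gram (fun i => 'X^i : {poly k})) != 0.
Proof.
have sw (a : 'I_#|strip_set|) : strip_word L 1 (enum_val a).
  by have := enum_valP a; rewrite inE.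
apply/eqP => d0.
have sz a b : (size (walk_gram (fun i => 'X^i : {poly k}) a b) <= (top_degree (enum_val a)).+1)%N.
  by rewrite mxE; apply: size_walk_form (sw a) _.
have := coef_det_top sz; rewrite d0 coef0 => /esym/eqP/det0P[u u0 uC].
have [a ua] : exists a, u 0 a != 0 by apply/rV0Pn.
(* At a largest element b of the support, column b has a single nonzero term. *)
pose b := [arg max_(b > a | u 0 b != 0) full_sum (enum_val b)].
have [ub bmax] : u 0 b != 0 /\ forall c, u 0 c != 0 -> (full_sum (enum_val c) <= full_sum (enum_val b))%N.
  by rewrite /b; case: arg_maxnP.
have /rowP/(_ b) := uC; rewrite !mxE (bigD1 b) //= big1 ?addr0 => [|c cb].
  by rewrite !mxE (lead_walk_form_diag _ (sw b)) mulr1 => /eqP; rewrite (negPf ub).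
rewrite !mxE; case: (eqVneq (u 0 c) 0) => [->|uc]; first by rewrite mul0r.
apply/eqP; rewrite mulf_eq0 (negPf uc) /=; apply/negPn/negP => /(lead_walk_form_neq (sw c)).
case=> [/enum_val_inj e|]; first by rewrite e eqxx in cb.
by rewrite ltnNge bmax.
Qed.
End Gram.

(** * Graded ideals of the exterior algebra *)

Section Graded.
Variables (k : fieldType) (n : nat).
Local Notation E := (extalg k n).
Implicit Types (S T : {set 'I_n}) (u v : E) (d : nat).

Lemma free_extb (P : pred {set 'I_n}) : free [seq extb k A | A in P].
Proof.
suff H : free [tuple of [seq extb k A | A in P]] by [].
apply/freeP => c /ffunP c0 i.
have := c0 (enum_val i); rewrite sum_ffunE ffunE (bigD1 i) //= big1 ?addr0 => [|j ji].
  by rewrite !ffunE nth_image ffunE eqxx /GRing.scale /= mulr1.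
rewrite !ffunE nth_image ffunE (inj_eq enum_val_inj) eq_sym (negPf ji).
exact: scaler0.
Qed.

Lemma ext_degP d u : reflect (forall S, u S != 0 -> #|S| = d) (u \in ext_deg k n d).
Proof.
apply: (iffP idP) => [ud S|supp].
  apply: contraNeq => Sd; rewrite (coord_span ud) sum_ffunE big1 // => i _.
  rewrite ffunE; set y := nth _ _ _; have : y \in [seq extb k A | A in [pred A : {set 'I_n} | #|A| == d]].
    by apply: mem_nth; rewrite ?size_image; apply: ltn_ord.
  case/imageP => A Ad ->; rewrite ffunE; case: eqP => [e|]; last by rewrite scaler0.
  by rewrite e in Sd; rewrite inE (negPf Sd) in Ad.
rewrite (extb_coord u) memv_suml // => S _.
case: (eqVneq (u S) 0) => [->|/supp Sd]; first by rewrite scale0r mem0v.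
by apply/memvZ/memv_span/image_f; rewrite inE Sd.
Qed.

Lemma extb_deg S : extb k S \in ext_deg k n #|S|.
Proof. by apply/ext_degP => T; rewrite ffunE; case: (T =P S) => [->|]; rewrite ?eqxx. Qed.

Lemma dim_ext_deg d : \dim (ext_deg k n d) = 'C(n, d).
Proof.
rewrite (eqP (free_extb _)) size_image -[in RHS](card_ord n) -card_draws.
by apply: eq_card => A; rewrite !inE.
Qed.

Lemma ext_mulE u v : u * v = \sum_S \sum_T (u S * v T : k) *: (extb k S * extb k T).
Proof.
rewrite {1}(extb_coord u) mulr_suml; apply: eq_bigr => S _.
rewrite {1}(extb_coord v) mulr_sumr; apply: eq_bigr => T _.
by rewrite -scalerAl -scalerAr scalerA.
Qed.

Lemma ext_deg_mul a b u v : u \in ext_deg k n a -> v \in ext_deg k n b ->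
  u * v \in ext_deg k n (a + b).
Proof.
move=> /ext_degP ua /ext_degP vb; rewrite ext_mulE.
apply: memv_suml => S _; apply: memv_suml => T _.
case: (eqVneq (u S) 0) => [->|/ua <-]; first by rewrite mul0r scale0r mem0v.
case: (eqVneq (v T) 0) => [->|/vb <-]; first by rewrite mulr0 scale0r mem0v.
apply: memvZ; rewrite extb_mul /ext_sign; case: ifP => [dST|]; last by rewrite scale0r mem0v.
have /eqP <- : #|S :|: T| == (#|S| + #|T|)%N by rewrite (leq_card_setU S T).2.
by apply: memvZ; apply: extb_deg.
Qed.

Lemma ext_inv_sum S T : [disjoint S & T] -> (ext_inv S T + ext_inv T S = #|S| * #|T|)%N.
Proof.
move=> dST; rewrite /ext_inv [X in (_ + X)%N]exchange_big /= -big_split /=.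
rewrite -sum_nat_const; apply: eq_bigr => i iS; rewrite -big_split /= -sum1_card.
apply: eq_bigr => j jT; have : i != j.
  by apply: contraTneq iS => ->; rewrite (disjointFl dST).
by rewrite -val_eqE /=; case: ltngtP.
Qed.

Lemma extb_comm S T : extb k S * extb k T = (-1) ^+ (#|S| * #|T|) *: (extb k T * extb k S).
Proof.
rewrite !extb_mul scalerA setUC; congr (_ *: _).
rewrite /ext_sign disjoint_sym; case: ifP => [d|]; last by rewrite mulr0.
by rewrite mulnC -(ext_inv_sum d) exprD mulrAC -expr2 sqrr_sign mul1r.
Qed.

Lemma ext_deg_comm a b u v : u \in ext_deg k n a -> v \in ext_deg k n b ->
  u * v = (-1) ^+ (a * b) *: (v * u).
Proof.
move=> /ext_degP ua /ext_degP vb; rewrite [u * v]ext_mulE [v * u]ext_mulE [X in _ *: X]exchange_big.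
rewrite scaler_sumr; apply: eq_bigr => S _; rewrite scaler_sumr; apply: eq_bigr => T _.
case: (eqVneq (u S) 0) => [->|/ua <-]; first by rewrite mulr0 mul0r !scale0r scaler0.
case: (eqVneq (v T) 0) => [->|/vb <-]; first by rewrite mulr0 mul0r !scale0r scaler0.
by rewrite extb_comm !scalerA; congr (_ *: _); rewrite [v T * u S]mulrC [LHS]mulrC.
Qed.

Lemma ext_deg2_central f u : f \in ext_deg k n 2 -> f * u = u * f.
Proof.
move=> f2; rewrite (extb_coord u) mulr_sumr mulr_suml; apply: eq_bigr => S _.
rewrite -scalerAl -scalerAr; congr (_ *: _).
by rewrite (ext_deg_comm f2 (extb_deg S)) exprM sqrrN !expr1n scale1r.
Qed.

Definition hcomp d u : E := [ffun S : {set 'I_n} => if #|S| == d then u S else 0].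

Lemma hcomp_linear d : linear (hcomp d).
Proof. by move=> a u v; apply/ffunP => S; rewrite !ffunE; case: ifP => //; rewrite scaler0 addr0. Qed.
HB.instance Definition _ d := GRing.isLinear.Build k E E _ (hcomp d) (hcomp_linear d).

Lemma hcomp_deg d u : hcomp d u \in ext_deg k n d.
Proof. by apply/ext_degP => S; rewrite ffunE; case: (#|S| =P d) => [->//|]; rewrite eqxx. Qed.

Lemma hcomp_id d u : u \in ext_deg k n d -> hcomp d u = u.
Proof.
move/ext_degP => ud; apply/ffunP => S; rewrite ffunE; case: eqP => // Sd.
by apply/esym/eqP/negPn/negP => /ud.
Qed.

Lemma hcomp_other d e u : u \in ext_deg k n e -> e != d -> hcomp d u = 0.
Proof.
move/ext_degP => ue ed; apply/ffunP => S; rewrite !ffunE; case: eqP => // Sd.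
by apply/eqP/negPn/negP => /ue; rewrite Sd => de; rewrite de eqxx in ed.
Qed.

Lemma hcomp_sum u : u = \sum_(d < n.+1) hcomp d u.
Proof.
apply/ffunP => S; rewrite sum_ffunE.
have Sn : (#|S| < n.+1)%N by rewrite ltnS -[X in (_ <= X)%N](card_ord n) max_card.
rewrite (bigD1 (Ordinal Sn)) //= big1 ?addr0 => [|i]; first by rewrite ffunE eqxx.
by rewrite ffunE -val_eqE /= eq_sym => /negPf->.
Qed.

Lemma hcomp_mul d f u : f \in ext_deg k n 2 -> hcomp d.+2 (f * u) = f * hcomp d u.
Proof.
move=> f2; rewrite (hcomp_sum u) mulr_sumr !raddf_sum mulr_sumr; apply: eq_bigr => e _ /=.
have fe : f * hcomp e u \in ext_deg k n e.+2 by apply: (ext_deg_mul f2); apply: hcomp_deg.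
case: (eqVneq (e : nat) d) => [ed|ed]; first by rewrite ed in fe *; rewrite (hcomp_id fe) (hcomp_id (hcomp_deg d u)).
by rewrite (hcomp_other fe) ?eqSS // (hcomp_other (hcomp_deg e u)) ?mulr0.
Qed.

Lemma hcomp_mul_low d f u : f \in ext_deg k n 2 -> (d < 2)%N -> hcomp d (f * u) = 0.
Proof.
move=> f2 d2; rewrite (hcomp_sum u) mulr_sumr raddf_sum big1 // => e _ /=.
have fe : f * hcomp e u \in ext_deg k n e.+2 by apply: (ext_deg_mul f2); apply: hcomp_deg.
by rewrite (hcomp_other fe) //; lia.
Qed.

Definition ideal_gens d f g : seq E :=
  [seq f * extb k T | T in [pred T : {set 'I_n} | (#|T| + 2 == d)%N]] ++
  [seq g * extb k T | T in [pred T : {set 'I_n} | (#|T| + 2 == d)%N]].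

Definition ideal_comp d f g : {vspace E} := <<ideal_gens d f g>>%VS.

Lemma ideal_comp_mem d f g u : u \in ext_deg k n d ->
  f * u \in ideal_comp d.+2 f g /\ g * u \in ideal_comp d.+2 f g.
Proof.
move/ext_degP => ud.
split; rewrite (extb_coord u) mulr_sumr memv_suml // => S _; rewrite -scalerAr.
  case: (eqVneq (u S) 0) => [->|/ud Sd]; first by rewrite scale0r mem0v.
  apply/memvZ/memv_span; rewrite mem_cat; apply/orP; left.
  by apply: (image_f (fun T => f * extb k T)); rewrite inE Sd addn2.
case: (eqVneq (u S) 0) => [->|/ud Sd]; first by rewrite scale0r mem0v.
apply/memvZ/memv_span; rewrite mem_cat; apply/orP; right.
by apply: (image_f (fun T => g * extb k T)); rewrite inE Sd addn2.
Qed.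

Lemma ideal_compP d f g (U : {vspace E}) :
  (forall T, (#|T| + 2 = d)%N -> f * extb k T \in U /\ g * extb k T \in U) ->
  (ideal_comp d f g <= U)%VS.
Proof.
move=> H; apply/span_subvP => u; rewrite mem_cat => /orP[] /imageP[T]; rewrite inE => /eqP Td ->.
  exact: (H T Td).1.
exact: (H T Td).2.
Qed.

Lemma ideal_comp_sub d f g : f \in ext_deg k n 2 -> g \in ext_deg k n 2 ->
  (ideal_comp d f g <= ext_deg k n d)%VS.
Proof.
move=> f2 g2; apply: ideal_compP => T <-; rewrite addnC.
by split; apply: ext_deg_mul => //; apply: extb_deg.
Qed.

(** Forms of degree 2 are central, so that the two-sided ideal is f E + g E. *)
Lemma ext_idealP f g u : f \in ext_deg k n 2 -> g \in ext_deg k n 2 ->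
  reflect (exists a b, u = f * a + g * b) (u \in ext_ideal f g).
Proof.
move=> f2 g2; apply: (iffP idP) => [|[a [b ->]]]; last first.
  have F h : h \in <<[:: f; g]>>%VS -> forall a, h * a \in ext_ideal f g.
    move=> hh c; rewrite /ext_ideal -[h]mul1r; apply: memv_mul; last exact: memvf.
    by apply: memv_mul; rewrite ?memvf.
  by rewrite memvD // F // memv_span // !inE eqxx ?orbT.
pose J := (limg (amull f) + limg (amull g))%VS.
have JP v : reflect (exists a b, v = f * a + g * b) (v \in J).
  apply: (iffP memv_addP) => [[x /memv_imgP[a _ ->] [y /memv_imgP[b _ ->] ->]]|[a [b ->]]].
    by exists a, b; rewrite !lfunE.
  exists (f * a); first by apply/memv_imgP; exists a; rewrite ?memvf ?lfunE.
  by exists (g * b) => //; apply/memv_imgP; exists b; rewrite ?memvf ?lfunE.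
move=> uI; apply/JP; move: u uI; apply/subvP/prodvP => x c; rewrite -/(in_mem x _) => xI _.
have /JP[a [b ->]] : x \in J.
  move: x xI; apply/subvP/prodvP => y h _; rewrite span_cons span_seq1.
  case/memv_addP => _ /vlineP[s ->] [_ /vlineP[t ->] ->].
  apply/JP; exists (s *: y), (t *: y).
  by rewrite mulrDr -!scalerAr !(ext_deg2_central _ f2, ext_deg2_central _ g2).
by apply/JP; exists (a * c), (b * c); rewrite mulrDl !mulrA.
Qed.

(** The ideal is homogeneous: project f a + g b to degree d. *)
Lemma ext_ideal_comp d f g : f \in ext_deg k n 2 -> g \in ext_deg k n 2 ->
  (ext_deg k n d :&: ext_ideal f g)%VS = ideal_comp d f g.
Proof.
move=> f2 g2; apply/eqP; rewrite eqEsubv subv_cap ideal_comp_sub //=.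
apply/andP; split.
  apply/subvP => u; rewrite memv_cap => /andP[ud /(ext_idealP _ f2 g2)[a [b e]]].
  rewrite -(hcomp_id ud) e linearD; case: d {ud} => [|[|d]] /=; try by rewrite !hcomp_mul_low // addr0 mem0v.
  rewrite !hcomp_mul //; apply: memvD.
    exact: (ideal_comp_mem f g (hcomp_deg d a)).1.
  exact: (ideal_comp_mem f g (hcomp_deg d b)).2.
apply: ideal_compP => T _; split; apply/ext_idealP => //.
  by exists (extb k T), 0; rewrite mulr0 addr0.
by exists 0, (extb k T); rewrite mulr0 add0r.
Qed.

Lemma hilbert_coefE d f g : f \in ext_deg k n 2 -> g \in ext_deg k n 2 ->
  (hilbert_coef (ext_ideal f g) d + \dim (ideal_comp d f g))%N = 'C(n, d).
Proof.
move=> f2 g2; rewrite -(ext_ideal_comp d f2 g2) /hilbert_coef addnC.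
by rewrite dimv_cap_compl dim_ext_deg.
Qed.
End Graded.

(** * Linear substitutions *)

Section Substitution.
Variables (k : fieldType) (n : nat).
Hypothesis char0 : [pchar k] =i pred0.
Local Notation E := (extalg k n).
Implicit Types (S T : {set 'I_n}) (u v : E) (i j : 'I_n).

Lemma enum_setU1_min i T : (forall j, j \in T -> (i < j)%N) -> enum (i |: T) = i :: enum T.
Proof.
move=> iT; pose r : rel 'I_n := fun a b => (a < b)%N.
have rt : transitive r by move=> a b c; apply: ltn_trans.
have ri : irreflexive r by move=> a; apply: ltnn.
have se (A : {set 'I_n}) : sorted r (enum A).
  suff: sorted ltn (map val (enum A)) by rewrite sorted_map.
  have := iota_ltn_sorted 0 n; rewrite -val_enum_ord enumT.
  by move=> /(subseq_sorted ltn_trans); apply; apply/map_subseq/filter_subseq.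
apply: (irr_sorted_eq rt ri (se _)).
  rewrite /= path_min_sorted ?se //; apply/allP => j.
  by rewrite mem_enum => /iT.
by move=> j; rewrite !(inE, mem_enum).
Qed.

Lemma extX_extb_min i T : (forall j, j \in T -> (i < j)%N) ->
  extX k i * extb k T = extb k (i |: T).
Proof.
by move=> iT; rewrite !extb_prod enum_setU1_min // big_cons.
Qed.

Lemma set_min T : T != set0 -> exists i T', [/\ T = i |: T', #|T| = #|T'|.+1 &
  forall j, j \in T' -> (i < j)%N].
Proof.
case/set0Pn => i0 i0T; pose i := [arg min_(i < i0 | i \in T) val i].
have [iT imin] : i \in T /\ forall j, j \in T -> (i <= j)%N by rewrite /i; case: arg_minnP.
exists i, (T :\ i); split; first by rewrite setD1K.
  by rewrite (cardsD1 i T) iT.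
move=> j; rewrite !inE => /andP[ji /imin]; rewrite leq_eqVlt => /predU1P[e|//].
by case/eqP: ji; apply/val_inj.
Qed.

Lemma deg1_sqr u : u \in ext_deg k n 1 -> u * u = 0.
Proof.
move=> u1; have := ext_deg_comm u1 u1; rewrite expr1 scaleN1r => /eqP.
by rewrite -addr_eq0 -mulr2n -scaler_nat scaler_eq0 natr_eq0_char0 //= => /eqP.
Qed.

Lemma deg1_anti u v : u \in ext_deg k n 1 -> v \in ext_deg k n 1 -> u * v = - (v * u).
Proof. by move=> u1 v1; rewrite (ext_deg_comm u1 v1) expr1 scaleN1r. Qed.

Lemma extb_set0 : extb k set0 = 1 :> E.
Proof. by []. Qed.

Lemma extX_deg i : extX k i \in ext_deg k n 1.
Proof. by have := extb_deg k [set i]; rewrite cards1. Qed.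

Variable xi : 'I_n -> E.
Hypothesis xi1 : forall i, xi i \in ext_deg k n 1.

Definition substitute u : E := \sum_S (u S : k) *: \prod_(i <- enum S) xi i.

Lemma subst_linear : linear substitute.
Proof.
move=> a u v; rewrite /substitute scaler_sumr -big_split; apply: eq_bigr => S _.
by rewrite !ffunE scalerDl scalerA.
Qed.
HB.instance Definition _ := GRing.isLinear.Build k E E _ substitute subst_linear.

Lemma subst_extb S : substitute (extb k S) = \prod_(i <- enum S) xi i.
Proof.
rewrite /substitute (bigD1 S) //= [X in _ + X]big1 ?addr0 => [|T TS]; rewrite ffunE.
  by rewrite eqxx scale1r.
by rewrite (negPf TS) scale0r.
Qed.

Lemma subst_extb_min i T : (forall j, j \in T -> (i < j)%N) ->
  substitute (extb k (i |: T)) = xi i * substitute (extb k T).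
Proof. by move=> iT; rewrite !subst_extb enum_setU1_min // big_cons. Qed.

Lemma subst_extX i : substitute (extX k i) = xi i.
Proof. by rewrite subst_extb enum_set1 big_seq1. Qed.

(** Sorting x_i into x_T costs a sign for each exchange, and the xi_j anticommute
like the generators.  By induction on T: if its smallest element j is below i,
exchange x_i and x_j; if it is i, both sides vanish. *)
Lemma subst_mulX i u : substitute (extX k i * u) = xi i * substitute u.
Proof.
rewrite (extb_coord u) mulr_sumr !raddf_sum mulr_sumr; apply: eq_bigr => T _ /=.
rewrite -scalerAr !linearZ -scalerAr /=; congr (_ *: _).
move: {2}#|T| (leqnn #|T|) i => N; elim: N T => [|N IH] T TN i.
  have -> : T = set0 by apply/eqP; rewrite -cards_eq0; lia.
  by rewrite extX_extb_min ?subst_extb_min // => j; rewrite inE.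
case: (eqVneq T set0) => [->|/set_min[j [T' [TE cT jT']]]].
  by rewrite extX_extb_min ?subst_extb_min // => j; rewrite inE.
have T'N : (#|T'| <= N)%N by lia.
rewrite {T}TE in TN cT *.
case: (ltngtP i j) => [ij|ij|/val_inj ij].
- have iT l : l \in j |: T' -> (i < l)%N.
    by rewrite !inE => /predU1P[->//|/jT']; apply: ltn_trans.
  by rewrite extX_extb_min // subst_extb_min.
- have E1 : substitute (extX k j * (extX k i * extb k T')) = xi j * substitute (extX k i * extb k T').
    have -> : extX k i * extb k T' = ext_sign k [set i] T' *: extb k (i |: T') by exact: extb_mul.
    have jiT' l : l \in i |: T' -> (j < l)%N by rewrite !inE => /predU1P[->//|/jT'].
    rewrite -scalerAr !linearZ /= -scalerAr; congr (_ *: _).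
    by rewrite extX_extb_min // subst_extb_min.
  rewrite -(extX_extb_min jT') (mulrA (extX k i)) extX_anti mulNr raddfN -mulrA /= E1.
  rewrite (IH T' T'N i) extX_extb_min // subst_extb_min //.
  by rewrite !mulrA (deg1_anti (xi1 i)) ?mulNr.
rewrite ij -(extX_extb_min jT') mulrA extX_sqr mul0r raddf0.
by rewrite extX_extb_min // subst_extb_min // mulrA deg1_sqr ?mul0r.
Qed.

Lemma substM u v : substitute (u * v) = substitute u * substitute v.
Proof.
rewrite (extb_coord u) mulr_suml !raddf_sum mulr_suml; apply: eq_bigr => S _ /=.
rewrite -scalerAl !linearZ -scalerAl /=; congr (_ *: _).
move: {2}#|S| (leqnn #|S|) => N; elim: N S => [|N IH] S SN.
  have -> : S = set0 by apply/eqP; rewrite -cards_eq0; lia.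
  by rewrite subst_extb enum_set0 big_nil extb_set0 !mul1r.
case: (eqVneq S set0) => [->|/set_min[j [S' [SE cS jS']]]].
  by rewrite subst_extb enum_set0 big_nil extb_set0 !mul1r.
rewrite SE subst_extb_min // -extX_extb_min // -!mulrA subst_mulX IH //; lia.
Qed.

Definition lifted_deg d u : Prop := exists2 v, v \in ext_deg k n d & substitute v = u.

Lemma subst_lift_extb : (forall i, lifted_deg 1 (extX k i)) ->
  forall S, lifted_deg #|S| (extb k S).
Proof.
move=> X S; move: {2}#|S| (leqnn #|S|) => N; elim: N S => [|N IH] S SN.
  have -> : S = set0 by apply/eqP; rewrite -cards_eq0; lia.
  by exists (extb k set0); rewrite ?extb_deg // subst_extb enum_set0 big_nil.
case: (eqVneq S set0) => [->|/set_min[j [S' [SE cS jS']]]].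
  by exists (extb k set0); rewrite ?extb_deg // subst_extb enum_set0 big_nil.
have [|v vd vS] := IH S'; first lia.
have [u ud uj] := X j; exists (u * v); last by rewrite substM uj vS SE extX_extb_min.
by rewrite cS -addn1 addnC ext_deg_mul.
Qed.

(** A substitution that reaches all the monomials in their degree maps the ideal of
(f, g) onto that of the substituted pair. *)
Lemma dim_ideal_substitute d f g : (forall i, lifted_deg 1 (extX k i)) ->
  (\dim (ideal_comp d (substitute f) (substitute g)) <= \dim (ideal_comp d f g))%N.
Proof.
move=> X; apply: (@leq_trans (\dim (linfun substitute @: ideal_comp d f g))); last first.
  by rewrite -(limg_ker_dim (linfun substitute) (ideal_comp d f g)) leq_addl.
apply/dimvS/ideal_compP => T Td; have [v vd <-] := subst_lift_extb X T.
have := ideal_comp_mem f g vd; rewrite -addn2 Td => -[hf hg].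
by split; rewrite -substM -(lfunE substitute) memv_img.
Qed.
End Substitution.

(** * Diagonal pairs *)

Section WordSets.
Variable m : nat.

Fact lo_proof (i : 'I_m) : (i.*2 < m.*2)%N. Proof. by rewrite ltn_double. Qed.
Fact hi_proof (i : 'I_m) : (i.*2.+1 < m.*2)%N. Proof. by have := ltn_ord i; lia. Qed.
Fact block_proof (j : 'I_m.*2) : (j./2 < m)%N. Proof. by have := ltn_ord j; lia. Qed.
Definition lo i := Ordinal (lo_proof i).
Definition hi i := Ordinal (hi_proof i).
Definition block j := Ordinal (block_proof j).

Lemma block_lo i : block (lo i) = i. Proof. by apply/val_inj; rewrite /= doubleK. Qed.
Lemma block_hi i : block (hi i) = i.
Proof. by apply/val_inj; rewrite /= uphalf_double. Qed.
Lemma odd_lo i : odd (lo i) = false. Proof. by rewrite /= odd_double. Qed.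
Lemma odd_hi i : odd (hi i). Proof. by rewrite /= odd_double. Qed.

Lemma lohiP (j : 'I_m.*2) : j = if odd j then hi (block j) else lo (block j).
Proof. by apply/val_inj; case: ifP => /= oj; rewrite -[LHS]odd_double_half oj. Qed.

Definition word_set (w : word m) : {set 'I_m.*2} :=
  [set j : 'I_m.*2 | if odd j then (w (block j)).2 else (w (block j)).1].
Definition set_word (S : {set 'I_m.*2}) : word m := [ffun i => (lo i \in S, hi i \in S)].

Lemma lo_word_set w i : (lo i \in word_set w) = (w i).1.
Proof. by rewrite inE odd_lo block_lo. Qed.
Lemma hi_word_set w i : (hi i \in word_set w) = (w i).2.
Proof. by rewrite inE odd_hi block_hi. Qed.

Lemma word_setK : cancel word_set set_word.
Proof.
by move=> w; apply/ffunP => i; rewrite ffunE lo_word_set hi_word_set; case: (w i).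
Qed.
Lemma set_wordK : cancel set_word word_set.
Proof.
move=> S; apply/setP => j; rewrite inE [in RHS](lohiP j).
by case: ifP => oj; rewrite ffunE.
Qed.

Lemma big_lohi (R : Type) (idx : R) (op : Monoid.com_law idx) (F : 'I_m.*2 -> R) :
  \big[op/idx]_j F j = \big[op/idx]_i op (F (lo i)) (F (hi i)).
Proof.
rewrite (reindex (fun p : 'I_m * bool => if p.2 then hi p.1 else lo p.1)) /=; last first.
  exists (fun j => (block j, odd j)) => [[i []] _|j _] /=.
  - by rewrite block_hi odd_double.
  - by rewrite block_lo odd_double.
  - by rewrite -lohiP.
rewrite -(pair_bigA _ (fun i (b : bool) => F (if b then hi i else lo i))) /=.
by apply: eq_bigr => i _; rewrite big_bool Monoid.mulmC.
Qed.

Lemma card_word_set w : #|word_set w| = wdeg w.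
Proof.
rewrite -sum1_card big_mkcond big_lohi; apply: eq_bigr => i _.
by rewrite lo_word_set hi_word_set; case: (w i) => [[] []].
Qed.

Lemma wdeg_strip L a (w : word m) : strip_word L a w -> (a + m = L.-1 + wdeg w)%N.
Proof.
suff H b s : strip_seq L b s ->
    (b + size s = L.-1 + \sum_(c <- s) (c.1 + c.2))%N.
  by move=> /H; rewrite size_codom card_ord /codom /image_mem big_map big_enum.
elim: s b => [|c s IH] b /= /andP[bL]; first by move=> /eqP ->; rewrite big_nil.
by move=> /IH; rewrite big_cons; case: c => [[] []] /=; move: bL => /andP[b0 _]; lia.
Qed.
End WordSets.

(** The coordinates of u - projv U u are functionals that kill U and detect whether
u lies in U. *)
Lemma sub_by_functionals (k : fieldType) (T : finType) (U W : {vspace {ffun T -> k^o}}) :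
  (forall La : {linear {ffun T -> k^o} -> k^o}, (forall u, u \in U -> La u = 0) ->
     forall u, u \in W -> La u = 0) -> (W <= U)%VS.
Proof.
move=> H; apply/subvP => u uW.
suff -> : u = projv U u by apply: memv_proj.
apply/eqP; rewrite -subr_eq0; apply/eqP/ffunP => t; rewrite [RHS]ffunE.
pose la (v : {ffun T -> k^o}) : k^o := (v - projv U v) t.
have la_lin : linear la by move=> s x y; rewrite /la linearP !ffunE /GRing.scale /=; ring.
apply: (H (HB.pack la (GRing.isLinear.Build _ _ _ _ la la_lin))) => // x xU.
by rewrite /= /la projv_id // subrr ffunE.
Qed.

Section Diagonal.
Variables (k : fieldType) (m : nat).
Hypothesis char0 : [pchar k] =i pred0.
Local Notation E := (extalg k m.*2).
Implicit Types (w v : word m) (i : 'I_m).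

Definition eword w : E := extb k (word_set w).

Definition quad i : E := extX k (lo i) * extX k (hi i).

Definition diag_form (a : 'I_m -> k) : E := \sum_i a i *: quad i.

Lemma quadE i : quad i = extb k [set lo i; hi i].
Proof.
rewrite /quad extb_mul /ext_sign disjoints1 inE -val_eqE /= ifT; last by rewrite neq_ltn ltnSn.
by rewrite /ext_inv !big_set1 /= ltnNge leqnSn expr0 scale1r.
Qed.

(** No sign appears: the two generators of a pair are neighbours, so each other
generator passes both of them or none. *)
Lemma quad_eword i w : quad i * eword w = if w i == empty then eword (fill w i) else 0.
Proof.
rewrite quadE extb_mul /ext_sign.
have -> : [disjoint [set lo i; hi i] & word_set w] = (w i == empty).
  rewrite -setI_eq0 setIUl setU_eq0 !setI_eq0 !disjoints1 lo_word_set hi_word_set.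
  by case: (w i) => [[] []].
case: eqP => wi; last by rewrite scale0r.
have -> : (-1) ^+ ext_inv [set lo i; hi i] (word_set w) = 1 :> k.
  have -> : ext_inv [set lo i; hi i] (word_set w) = (2 * \sum_(j in word_set w) (j < lo i))%N.
    rewrite /ext_inv big_setU1 ?big_set1 /=; last by rewrite inE -val_eqE /=; lia.
    rewrite mul2n -[RHS]addnn; congr (_ + _)%N; apply: eq_bigr => j jw.
    have: j != lo i by apply: contraTneq jw => ->; rewrite lo_word_set wi.
    by rewrite -val_eqE /= ltnS leq_eqVlt => /negPf ->.
  by rewrite exprM sqrrN !expr1n.
rewrite scale1r; congr extb; apply/setP => j; rewrite !inE [in RHS]ffunE.
rewrite {1 2}(lohiP j); case: (eqVneq (block j) i) => [<-|ni].
  by case: (odd j); rewrite ?eqxx ?orbT.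
have -> : ((if odd j then hi (block j) else lo (block j)) == lo i) = false.
  by apply/negP => /eqP e; case/eqP: ni; rewrite -(block_lo i) -e; case: (odd j); rewrite ?block_hi ?block_lo.
have -> // : ((if odd j then hi (block j) else lo (block j)) == hi i) = false.
by apply/negP => /eqP e; case/eqP: ni; rewrite -(block_hi i) -e; case: (odd j); rewrite ?block_hi ?block_lo.
Qed.

Lemma quad_deg i : quad i \in ext_deg k m.*2 2.
Proof. exact: (ext_deg_mul (extX_deg _ _) (extX_deg _ _)). Qed.

Lemma diag_form_deg a : diag_form a \in ext_deg k m.*2 2.
Proof. by apply: memv_suml => i _; apply/memvZ/quad_deg. Qed.

Lemma diag_form_eword a w :
  diag_form a * eword w = \sum_(i | w i == empty) a i *: eword (fill w i).
Proof.
rewrite mulr_suml [RHS]big_mkcond; apply: eq_bigr => i _.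
by rewrite -scalerAl quad_eword; case: ifP => //; rewrite scaler0.
Qed.

Lemma extb_eword S : extb k S = eword (set_word S).
Proof. by rewrite /eword set_wordK. Qed.

(** The functionals given by [walk_form] kill the ideal and are independent on the
strip words. *)
Lemma dim_ideal_diag_le d (lam : 'I_m -> k) : (d <= m)%N ->
  \det (walk_gram (m.+2 - d) lam) != 0 ->
  (\dim (ideal_comp d (diag_form (fun=> 1%R)) (diag_form lam)) + #|strip_set m (m.+2 - d)|
     <= 'C(m.*2, d))%N.
Proof.
move=> dm; set L := (m.+2 - d)%N; set N := #|_| => det0.
pose psi (u : E) : 'rV[k]_N :=
  \row_a \sum_(w : word m) walk_form (enum_val a) lam w * u (word_set w).
have psi_lin : linear psi.
  move=> t u v; apply/rowP => a; rewrite !mxE mulr_sumr -big_split; apply: eq_bigr => w _ /=.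
  by rewrite !ffunE /GRing.scale /=; ring.
pose Psi : {linear E -> 'rV[k]_N} := HB.pack psi (GRing.isLinear.Build _ _ _ _ psi psi_lin).
have PsiE u : Psi u = psi u by [].
have PsiLE u : linfun Psi u = psi u := lfunE Psi u.
have psi_eword w : psi (eword w) = \row_a walk_form (enum_val a) lam w.
  apply/rowP => a; rewrite !mxE (bigD1 w) //= big1 ?addr0 => [|w' ne].
    by rewrite ffunE eqxx mulr1.
  by rewrite ffunE (inj_eq (can_inj (@word_setK m))) (negPf ne) mulr0.
have sw (a : 'I_N) : strip_word L 1 (enum_val a) by have := enum_valP a; rewrite inE.
have kill (b : bool) w : psi (diag_form (fun i => lam i ^+ b) * eword w) = 0.
  rewrite diag_form_eword -PsiE raddf_sum /=; apply/rowP => a; rewrite summxE [RHS]mxE.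
  rewrite -[RHS](walk_form_annihilated lam w b (sw a)); apply: eq_bigr => i _.
  by rewrite -PsiE linearZ PsiE psi_eword !mxE.
have sub : (ideal_comp d (diag_form (fun=> 1%R)) (diag_form lam) <=
            ext_deg k m.*2 d :&: lker (linfun Psi))%VS.
  rewrite subv_cap ideal_comp_sub ?diag_form_deg //=.
  apply: ideal_compP => T _; rewrite extb_eword !memv_ker !PsiLE.
  by split; apply/eqP; [apply: (kill false)|apply: (kill true)].
have full : (fullv <= linfun Psi @: ext_deg k m.*2 d)%VS.
  apply/subvP => r _.
  have gu : walk_gram L lam \in unitmx by rewrite unitmxE unitfE.
  pose c := r *m invmx (walk_gram L lam)^T.
  have -> : r = linfun Psi (\sum_b c 0 b *: eword (enum_val b)).
    rewrite PsiLE -PsiE raddf_sum /=; apply/rowP => a; rewrite summxE.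
    have -> : r = c *m (walk_gram L lam)^T by rewrite mulmxKV // unitmx_tr.
    rewrite mxE; apply: eq_bigr => b _; rewrite -PsiE linearZ PsiE psi_eword !mxE.
    by [].
  apply: memv_img; apply: memv_suml => b _; apply: memvZ.
  have <- : #|word_set (enum_val b)| = d.
    by rewrite card_word_set; have := wdeg_strip (sw b); rewrite /L; lia.
  exact: extb_deg.
rewrite -(dim_ext_deg k) -(limg_ker_dim (linfun Psi) (ext_deg k m.*2 d)); apply: leq_add; first exact: dimvS.
by apply: leq_trans (dimvS full); rewrite dimvf /dim /= mul1n.
Qed.

Let functional_form (La : {linear {ffun {set 'I_m.*2} -> k^o} -> k^o}) d : {ffun word m -> k^o} :=
  [ffun w : word m => (if wdeg w == d then La (eword w) else 0) : k^o].

Lemma wdeg_fill i w : w i == empty -> wdeg (fill w i) = (wdeg w).+2.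
Proof.
move=> /eqP wi; rewrite /wdeg (bigD1 i) //= [in RHS](bigD1 i) //= ffunE eqxx wi.
rewrite (eq_bigr (fun j => (w j).1 + (w j).2)%N) // => j ji.
by rewrite ffunE (negPf ji).
Qed.

Let contract_functional (La : {linear {ffun {set 'I_m.*2} -> k^o} -> k^o}) d a :
  (forall T : {set 'I_m.*2}, (#|T| + 2 = d)%N -> La (diag_form a * extb k T) = 0) ->
  contract a (functional_form La d) = 0.
Proof.
move=> H; apply/ffunP => w; rewrite !ffunE.
case: (eqVneq (wdeg w + 2)%N d) => wd.
  have := H (word_set w); rewrite card_word_set => /(_ wd).
  rewrite -/(eword w) diag_form_eword raddf_sum /= => e; rewrite -[RHS]e.
  apply: eq_bigr => i wi; rewrite ffunE wdeg_fill // -addn2 wd eqxx.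
  by rewrite linearZ.
by rewrite big1 // => i wi; rewrite ffunE wdeg_fill // -addn2 (negPf wd) mulr0.
Qed.

Let functional_form_eq0 (La : {linear {ffun {set 'I_m.*2} -> k^o} -> k^o}) d : functional_form La d = 0 ->
  forall u : E, u \in ext_deg k m.*2 d -> La u = 0.
Proof.
move=> /ffunP e u /ext_degP ud; rewrite (extb_coord u) raddf_sum big1 // => S _ /=.
rewrite linearZ /=; case: (eqVneq (u S) 0) => [->|/ud Sd]; first by rewrite scale0r.
have := e (set_word S); rewrite !ffunE -card_word_set set_wordK Sd eqxx -extb_eword => ->.
by rewrite scaler0.
Qed.

(** By duality, the ideal and the strip words span the degree d part. *)
Lemma dim_ideal_diag_ge d (lam : 'I_m -> k) : strip_determined lam 1 (m.+2 - d) -> (d <= m)%N ->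
  ('C(m.*2, d) <= \dim (ideal_comp d (diag_form (fun=> 1%R)) (diag_form lam))
                  + #|strip_set m (m.+2 - d)|)%N.
Proof.
move=> det dm; set L := (m.+2 - d)%N; set I := ideal_comp _ _ _.
pose X := [seq eword w | w in strip_set m L].
rewrite -(dim_ext_deg k).
have -> : #|strip_set m L| = size X by rewrite size_image.
apply: (@leq_trans (\dim (I + <<X>>)%VS)); last first.
  by apply: leq_trans (dimv_add_leqif _ _).1 _; rewrite leq_add2l dim_span.
apply: dimvS; apply: sub_by_functionals => La kill.
apply: functional_form_eq0; apply: det.
- move=> w; rewrite ffunE; case: (wdeg w =P d) => [->|]; last by rewrite eqxx.
  by rewrite /L; lia.
- move=> w sw; rewrite ffunE; case: eqP => // _; apply: kill.
  apply: (subvP (addvSr _ _)); apply: memv_span; apply: image_f; rewrite inE //.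
- apply: contract_functional => T Td; apply: kill; apply: (subvP (addvSl _ _)).
  have Tdeg := extb_deg k T.
  have := ideal_comp_mem (diag_form (fun=> 1)) (diag_form lam) Tdeg.
  by rewrite -addn2 Td => -[].
apply: contract_functional => T Td; apply: kill; apply: (subvP (addvSl _ _)).
have Tdeg := extb_deg k T.
have := ideal_comp_mem (diag_form (fun=> 1)) (diag_form lam) Tdeg.
by rewrite -addn2 Td => -[].
Qed.

(** Above degree m already the multiples of sum_i z_i fill everything. *)
Lemma dim_ideal_diag_high d (lam : 'I_m -> k) : (m < d)%N ->
  ('C(m.*2, d) <= \dim (ideal_comp d (diag_form (fun=> 1%R)) (diag_form lam)))%N.
Proof.
move=> md; rewrite -(dim_ext_deg k); apply: dimvS; apply: sub_by_functionals => La kill.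
apply: functional_form_eq0; apply: (@iter_contract_injective _ char0 _ (fun=> 1) 1) => [i|w|].
- exact: oner_neq0.
- by rewrite ffunE; case: (wdeg w =P d) => [-> _|]; [rewrite addn1|rewrite eqxx].
apply: contract_functional => T Td; apply: kill.
have Tdeg := extb_deg k T.
have := ideal_comp_mem (diag_form (fun=> 1)) (diag_form lam) Tdeg.
by rewrite -addn2 Td => -[].
Qed.
End Diagonal.

(** * Determinants that vanish along curves *)

(** Suppose that through b there is, for every direction y, a cubic curve tangent
to y along which det (ell v) vanishes for almost all parameters.  If n is the
lowest order in t of det (ell (b + t y)) over all y, then along the curve the
coefficient of t^n is the same as along the line b + t y, so it is zero. *)
Section Curve.
Variables (k : fieldType).
Hypothesis char0 : [pchar k] =i pred0.

Lemma poly_vanish (p : {poly k}) : (forall x, p.[x] = 0) -> p = 0.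
Proof.
move=> h; apply/eqP/negPn/negP => /(nonroot_exists char0)[x].
by rewrite h eqxx.
Qed.

Variables (V : lmodType k) (r : nat) (ell : V -> 'M[k]_r) (W : V -> Prop) (b : V).
Hypothesis ell_lin : linear ell.
Hypothesis W_lin : forall a u v, W u -> W v -> W (a *: u + v).
Hypothesis curves : forall y, W y -> exists z0 z1 (e : {poly k}),
  [/\ W z0, W z1, e != 0 &
      forall u, e.[u] != 0 -> \det (ell (b + u *: (y + u *: (z0 + u *: z1)))) = 0].

Let ellD u v : ell (u + v) = ell u + ell v.
Proof. by have := ell_lin 1 u v; rewrite !scale1r. Qed.
Let ellZ a u : ell (a *: u) = a *: ell u.
Proof.
have ell0 : ell 0 = 0.
  by have := ell_lin (-1) 0 0; rewrite scaler0 addr0 scaleN1r addNr.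
by have := ell_lin a u 0; rewrite !addr0 ell0 addr0.
Qed.

Let line (y : V) : {poly k} :=
  \det (map_mx polyC (ell b) + 'X *: map_mx polyC (ell y)).

Let lineE y u : (line y).[u] = \det (ell (b + u *: y)).
Proof.
rewrite -[LHS]/(horner_eval u _) -det_map_mx; congr (\det _).
by apply/matrixP => i j; rewrite ellD ellZ !mxE /= /horner_eval !hornerE.
Qed.

Let line0 n : forall y, W y -> (line y)`_n = 0.
Proof.
elim/ltn_ind: n => n IH y Wy; have [z0 [z1 [e [Wz0 Wz1 e0 he]]]] := curves Wy.
(* det (ell (b + 'X (y + u z0 + u^2 z1))), with u the variable of the coefficients. *)
pose D : {poly {poly k}} :=
  \det (map_mx (polyC \o polyC) (ell b) + 'X *: map_mx polyC
     (map_mx polyC (ell y) + 'X *: (map_mx polyC (ell z0) + 'X *: map_mx polyC (ell z1)))).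
have DE u : map_poly (horner_eval u) D = line (y + u *: (z0 + u *: z1)).
  rewrite -det_map_mx; congr (\det _); apply/matrixP => i j.
  rewrite !ellD !ellZ !ellD !ellZ !mxE /= rmorphD rmorphM /= map_polyX !map_polyC /=.
  by rewrite /horner_eval !hornerE.
(* For each value of u this is a line through b, to which the induction applies. *)
have D0 i : (i < n)%N -> D`_i = 0.
  move=> ilt; apply: poly_vanish => u; rewrite -[LHS]/(horner_eval u _) -coef_map DE.
  apply: IH => //; rewrite addrC; apply: W_lin => //; rewrite addrC; exact: W_lin.
(* Equating the two variables gives the determinant along the curve. *)
have P0 : D.['X] = 0.
  apply/eqP; suff: e * D.['X] == 0 by rewrite mulf_eq0 (negPf e0).
  apply/eqP/poly_vanish => u; rewrite hornerM.
  case: (eqVneq e.[u] 0) => [->|/he h]; first by rewrite mul0r.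
  suff -> : D.['X].[u] = \det (ell (b + u *: (y + u *: (z0 + u *: z1)))) by rewrite h mulr0.
  rewrite -[LHS]/(horner_eval u (horner_eval 'X D)) /D -!det_map_mx; congr (\det _).
  apply/matrixP => i j; rewrite !(ellD, ellZ) !mxE /= /horner_eval.
  by rewrite !hornerE.
have := congr1 (fun p : {poly k} => p`_n) P0.
rewrite coef0 (@horner_coef_wide _ (maxn n.+1 (size D))) ?leq_maxr // coef_sum.
have lt_n : (n < maxn n.+1 (size D))%N by rewrite leq_max ltnSn.
rewrite (bigD1 (Ordinal lt_n)) //= big1 ?addr0 => [|i].
  by rewrite coefMXn ltnn subnn -horner_coef0 -[LHS]/(horner_eval 0 _) -coef_map DE scale0r addr0.
rewrite -val_eqE /= => ni; rewrite coefMXn; case: ltnP => // le.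
by rewrite D0 ?coef0 // ltn_neqAle ni.
Qed.

Lemma vanish_along_curves y : W y -> \det (ell (b + y)) = 0.
Proof.
move=> Wy; rewrite -[y in LHS]scale1r -lineE (_ : line y = 0) ?horner0 //.
by apply/polyP => i; rewrite line0 ?coef0.
Qed.
End Curve.

Section Minors.
Variable k : fieldType.

Lemma minor_of_rank m n r (M : 'M[k]_(m, n)) : (r <= \rank M)%N ->
  exists A : 'M_(r, m), exists B : 'M_(n, r), \det (A *m M *m B) != 0.
Proof.
move=> rM.
exists (pid_mx r *m invmx (col_ebase M)), (invmx (row_ebase M) *m pid_mx r).
rewrite -{2}(mulmx_ebase M) !mulmxA mulmxKV ?col_ebase_unit // mulmxK ?row_ebase_unit //.
have rm := leq_trans rM (rank_leq_row M); have rn := leq_trans rM (rank_leq_col M).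
rewrite !mul_pid_mx (_ : minn _ _ = r); last lia.
by rewrite pid_mx_1 det1 oner_eq0.
Qed.

Lemma rank_of_minor m n r (M : 'M[k]_(m, n)) A B :
  \det (A *m M *m B : 'M_r) != 0 -> (r <= \rank M)%N.
Proof.
rewrite -unitfE -unitmxE -row_free_unit => /eqP <-.
exact: leq_trans (mxrankM_maxl _ _) (mxrankM_maxr _ _).
Qed.
End Minors.

(** * Tangent directions at a diagonal pair *)

Section GensMatrix.
Variables (k : fieldType) (n d : nat).
Local Notation E := (extalg k n).
Let P := [pred T : {set 'I_n} | (#|T| + 2 == d)%N].

Definition gens_mx (p : E * E) : 'M[k]_(#|P| + #|P|, dim E) :=
  col_mx (\matrix_(i < #|P|) v2r (p.1 * extb k (enum_val i)))
         (\matrix_(i < #|P|) v2r (p.2 * extb k (enum_val i))).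

Lemma gens_mx_linear : linear gens_mx.
Proof.
move=> a u v; rewrite /gens_mx scale_col_mx add_col_mx; congr col_mx.
  by apply/row_matrixP => i; rewrite [RHS]linearP /= !rowK mulrDl -scalerAl linearP.
by apply/row_matrixP => i; rewrite [RHS]linearP /= !rowK mulrDl -scalerAl linearP.
Qed.

(** The rows are the coordinates of the generators f e_T, g e_T of the degree d part
of the ideal; the matrix is linear in (f, g), which makes its minors polynomials. *)
Lemma rank_gens_mx f g : \rank (gens_mx (f, g)) = \dim (ideal_comp d f g).
Proof.
have memK (v : E) (U : {vspace E}) : (v \in U) = (v2r v <= vs2mx U)%MS by rewrite -genmxE.
have E2 : (ideal_comp d f g <= mx2vs (gens_mx (f, g)))%VS.
  apply: ideal_compP => T /eqP Td; have PT : T \in P by rewrite inE.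
  rewrite !memK !mx2vsK -!addsmxE; split.
    apply: submx_trans (addsmxSl _ _).
    by rewrite -(enum_rankK_in PT PT) (eq_row_sub (enum_rank_in PT T)) ?rowK.
  apply: submx_trans (addsmxSr _ _).
  by rewrite -(enum_rankK_in PT PT) (eq_row_sub (enum_rank_in PT T)) ?rowK.
have E1 : (mx2vs (gens_mx (f, g)) <= ideal_comp d f g)%VS.
  rewrite /subsetv mx2vsK -addsmxE addsmx_sub.
  by apply/andP; split; apply/row_subP => i; rewrite rowK -memK memv_span // mem_cat;
    apply/orP; [left|right];
    [apply: (image_f (fun T => f * extb k T))|apply: (image_f (fun T => g * extb k T))];
    apply: enum_valP.
have /eqP -> : ideal_comp d f g == mx2vs (gens_mx (f, g)) by rewrite eqEsubv E1 E2.
by rewrite /dimv mx2vsK.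
Qed.
End GensMatrix.

Section Tangent.
Variables (k : fieldType) (m : nat) (lam : 'I_m -> k).
Hypothesis char0 : [pchar k] =i pred0.
Hypothesis lam_inj : injective lam.
Local Notation E := (extalg k m.*2).
Local Notation X := (extX k).

Definition quad_variation (eta : 'I_m.*2 -> E) i : E :=
  eta (lo i) * X (hi i) + X (lo i) * eta (hi i).

(** The first order variation of (f0, g_lam) when each generator x_j moves by
eta_j and each lam_i by del_i. *)
Definition reachable (y : E * E) : Prop := exists (eta : 'I_m.*2 -> E) (del : 'I_m -> k),
  [/\ forall j, eta j \in ext_deg k m.*2 1,
      y.1 = \sum_i quad_variation eta i &
      y.2 = \sum_i (lam i *: quad_variation eta i + del i *: quad k i)].

Lemma quad_variationP a (e e' : 'I_m.*2 -> E) i :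
  quad_variation (fun j => a *: e j + e' j) i = a *: quad_variation e i + quad_variation e' i.
Proof.
rewrite /quad_variation mulrDl mulrDr -scalerAl -scalerAr scalerDr.
by rewrite addrACA.
Qed.

Lemma reachableP a y z : reachable y -> reachable z -> reachable (a *: y + z).
Proof.
move=> [e [de [e1 y1 y2]]] [e' [de' [e1' z1 z2]]].
exists (fun j => a *: e j + e' j), (fun i => a * de i + de' i); split => [j||].
- by rewrite memvD ?memvZ.
- rewrite /= y1 z1 scaler_sumr -big_split; apply: eq_bigr => i _.
  by rewrite quad_variationP.
rewrite /= y2 z2 scaler_sumr -big_split; apply: eq_bigr => i _ /=.
rewrite quad_variationP !scalerDr scalerDl !scalerA [lam i * a]mulrC.
by rewrite addrACA.
Qed.

Lemma reachable_quad i : reachable (0, quad k i).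
Proof.
exists (fun=> 0), (fun j => (j == i)%:R); split => [j||] /=; first exact: mem0v.
  by rewrite big1 // => j _; rewrite /quad_variation mul0r mulr0 addr0.
rewrite (bigD1 i) //= big1 => [|j /negPf ji].
  by rewrite /quad_variation mul0r mulr0 !addr0 scaler0 add0r eqxx scale1r.
by rewrite /quad_variation mul0r mulr0 addr0 scaler0 add0r ji scale0r.
Qed.

(** Moving only the generator paired with x_a produces x_a y, with weight
lam_(block a) in the second form. *)
Lemma reachable_mulX a y : y \in ext_deg k m.*2 1 ->
  reachable (X a * y, lam (block a) *: (X a * y)).
Proof.
move=> y1; pose b := if odd a then lo (block a) else hi (block a).
pose c : k := if odd a then -1 else 1.
pose eta j := if j == b then c *: y else 0.
have V0 i : i != block a -> quad_variation eta i = 0.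
  have hb : block b = block a by rewrite /b; case: ifP => _; rewrite ?block_lo ?block_hi.
  move=> ni; rewrite /quad_variation /eta.
  have /negPf-> : lo i != b by apply: contraNneq ni => e; rewrite -hb -e block_lo.
  have /negPf-> : hi i != b by apply: contraNneq ni => e; rewrite -hb -e block_hi.
  by rewrite mul0r mulr0 addr0.
have Va : quad_variation eta (block a) = X a * y.
  rewrite /quad_variation /eta /b /c [in RHS](lohiP a).
  have lh : (lo (block a) == hi (block a)) = false by apply/eqP => /(congr1 val) /=; lia.
  case: (odd a); rewrite ?eqxx ?lh ?[hi _ == _]eq_sym ?lh.
    by rewrite mulr0 addr0 -scalerAl scaleN1r (deg1_anti y1) ?opprK // extX_deg.
  by rewrite mul0r add0r scale1r.
exists eta, (fun=> 0); split => [j||] /=.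
- by rewrite /eta; case: ifP => _; rewrite ?memvZ ?mem0v.
- by rewrite (bigD1 (block a)) //= Va big1 ?addr0 // => i /V0.
rewrite (bigD1 (block a)) //= Va big1 ?addr0 ?scale0r ?addr0 // => i /V0 ->.
by rewrite scaler0 scale0r addr0.
Qed.

(** x_a x_b arises from moving the partner of a or that of b, with weights
lam_(block a) and lam_(block b); if these differ, both components can be
prescribed.  Within a block, the variation of lam does it. *)
Lemma reachable_snd a b : reachable (0, X a * X b).
Proof.
have r0 : reachable (0, 0).
  by have q := reachable_quad (block a); have := reachableP (-1) q q; rewrite scaleN1r addNr.
have scal c y : reachable y -> reachable (c *: y) by move=> /(reachableP c)/(_ r0); rewrite addr0.
case: (eqVneq (block a) (block b)) => hab.
  case: (eqVneq a b) => [->|nab]; first by rewrite extX_sqr.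
  have ob : odd b = ~~ odd a.
    by case oa: (odd a); case ob: (odd b) => //; case/eqP: nab;
      rewrite (lohiP a) (lohiP b) oa ob hab.
  have := reachable_quad (block a); rewrite /quad.
  case oa: (odd a); rewrite oa /= in ob.
    have <- : a = hi (block a) by rewrite {1}(lohiP a) oa.
    have <- : b = lo (block a) by rewrite hab {1}(lohiP b) ob.
    by move/(scal (-1)); rewrite [X a * X b]extX_anti; congr reachable;
      congr (_, _); rewrite /= ?scaler0 ?scaleN1r.
  have <- : a = lo (block a) by rewrite {1}(lohiP a) oa.
  by have <- : b = hi (block a) by rewrite hab {1}(lohiP b) ob.
have c0 : lam (block a) - lam (block b) != 0.
  by rewrite subr_eq0; apply: contra hab => /eqP/lam_inj ->.
(* The sum is (0, (lam_a - lam_b) x_a x_b), as x_b x_a = - x_a x_b. *)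
have := reachableP 1 (reachable_mulX a (extX_deg k b)) (reachable_mulX b (extX_deg k a)).
rewrite scale1r [X b * X a]extX_anti => /(scal (lam (block a) - lam (block b))^-1).
congr reachable; congr (_, _) => /=; first by rewrite subrr scaler0.
by rewrite scalerN -scalerBl scalerA mulVf // scale1r.
Qed.

Lemma reachable_fst a b : reachable (X a * X b, 0).
Proof.
have := reachableP (- lam (block a)) (reachable_snd a b) (reachable_mulX a (extX_deg k b)).
congr reachable; congr (_, _) => /=; first by rewrite scaler0 add0r.
by rewrite scaleNr addNr.
Qed.

Lemma extb_deg2 (S : {set 'I_m.*2}) : #|S| = 2%N -> exists a b, exists c : k, extb k S = c *: (X a * X b).
Proof.
move=> /eqP/cards2P[a [b [ab ->]]]; exists a, b, (ext_sign k [set a] [set b])^-1.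
rewrite extb_mul scalerA mulVf ?scale1r //.
by rewrite /ext_sign disjoints1 inE ab signr_eq0.
Qed.

Lemma reachable_all f g : f \in ext_deg k m.*2 2 -> g \in ext_deg k m.*2 2 ->
  reachable (f, g).
Proof.
have r0 : reachable (0, 0).
  exists (fun=> 0), (fun=> 0); split => [j||] /=; first exact: mem0v.
    by rewrite big1 // => i _; rewrite /quad_variation mul0r mulr0 addr0.
  by rewrite big1 // => i _; rewrite /quad_variation mul0r mulr0 addr0 scaler0 scale0r addr0.
have fst u : u \in ext_deg k m.*2 2 -> reachable (u, 0).
  move=> /ext_degP ud; rewrite (extb_coord u).
  elim/big_rec: _ => [|S v _ IH]; first exact: r0.
  case: (eqVneq (u S) 0) => [->|/ud /extb_deg2[a [b [c ->]]]]; first by rewrite scale0r add0r.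
  have := reachableP (u S * c) (reachable_fst a b) IH.
  by congr reachable; congr (_, _) => /=; rewrite ?scalerA // scaler0 add0r.
have snd u : u \in ext_deg k m.*2 2 -> reachable (0, u).
  move=> /ext_degP ud; rewrite (extb_coord u).
  elim/big_rec: _ => [|S v _ IH]; first exact: r0.
  case: (eqVneq (u S) 0) => [->|/ud /extb_deg2[a [b [c ->]]]]; first by rewrite scale0r add0r.
  have := reachableP (u S * c) (reachable_snd a b) IH.
  by congr reachable; congr (_, _) => /=; rewrite ?scalerA // scaler0 add0r.
move=> f2 g2; have := reachableP 1 (fst _ f2) (snd _ g2).
by rewrite scale1r; congr reachable; congr (_, _) => /=; rewrite ?addr0 ?add0r.
Qed.
End Tangent.

(** * The bound for all pairs *)

Section AllPairs.
Variables (k : fieldType) (m : nat).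
Hypothesis char0 : [pchar k] =i pred0.
Local Notation E := (extalg k m.*2).
Local Notation X := (extX k).

Lemma eq_walk_gram (R : comNzRingType) L (lam lam' : 'I_m -> R) : lam =1 lam' ->
  walk_gram L lam = walk_gram L lam'.
Proof.
move=> h; apply/matrixP => a b; rewrite !mxE /walk_form; case: ifP => // _.
by congr (\det _); apply/matrixP => i j; rewrite !mxE h.
Qed.

(** lam_i = t^i for a generic t. *)
Lemma base_point L : exists lam : 'I_m -> k,
  injective lam /\ \det (walk_gram L lam) != 0.
Proof.
(* Nonzero at t exactly when the powers t^i are distinct. *)
pose dl : {poly k} := \prod_(p : 'I_m * 'I_m | (p.1 < p.2)%N) ('X^(p.2) - 'X^(p.1)).
have dl0 : dl != 0.
  apply/prodf_neq0 => -[i j] /= ij; rewrite subr_eq0; apply/eqP => /(congr1 (size (T := k) \o polyseq)) /=.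
  by rewrite !size_polyXn => -[e]; rewrite e ltnn in ij.
have [t] := nonroot_exists char0 (mulf_neq0 dl0 (det_walk_gram_neq0 m L k)).
rewrite hornerM mulf_eq0 negb_or => /andP[t1 t2]; exists (fun i => t ^+ i); split.
  have lt (i j : 'I_m) : (i < j)%N -> t ^+ i != t ^+ j :> k.
    move=> ij; move: t1; rewrite horner_prod => /prodf_neq0/(_ (i, j) ij) /=.
    by rewrite !hornerE subr_eq0 eq_sym.
  move=> i j e; apply/val_inj; case: (ltngtP i j) => // /lt.
    by rewrite e eqxx.
  by rewrite e eqxx.
move: t2; rewrite -[_.[t]]/(horner_eval t _) -det_map_mx map_walk_gram.
rewrite (@eq_walk_gram _ L _ (fun i : 'I_m => t ^+ i)) // => i.
by rewrite /= /horner_eval !hornerE.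
Qed.

Lemma deg1_expand (u : E) : u \in ext_deg k m.*2 1 -> u = \sum_l u [set l] *: X l.
Proof.
move/ext_degP => u1; apply/ffunP => S; rewrite sum_ffunE.
case: (boolP (#|S| == 1%N)) => [/cards1P[a ->]|nS].
  rewrite (bigD1 a) //= big1 ?addr0 => [|b ba]; rewrite !ffunE.
    by rewrite eqxx /GRing.scale /= mulr1.
  by rewrite (inj_eq set1_inj) eq_sym (negPf ba) scaler0.
rewrite big1 => [|a _]; first by apply/eqP/negPn/negP => /u1/eqP; rewrite (negPf nS).
rewrite !ffunE; case: eqP => [e|]; last by rewrite scaler0.
by rewrite e cards1 in nS.
Qed.

Local Notation f0 := (diag_form (fun=> 1 : k)).

(** If the bound failed at (f, g), some minor of the generator matrix would be
nonzero there, although it vanishes along the curves through a diagonal pair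
obtained by substituting x_j + u eta_j for x_j and lam_i + u del_i for lam_i. *)
Lemma dim_ideal_le d (f g : E) : (d <= m)%N ->
  f \in ext_deg k m.*2 2 -> g \in ext_deg k m.*2 2 ->
  (\dim (ideal_comp d f g) + #|strip_set m (m.+2 - d)| <= 'C(m.*2, d))%N.
Proof.
move=> dm f2 g2; set L := (m.+2 - d)%N.
have [lam [lam_inj gram0]] := base_point L.
have bound := dim_ideal_diag_le dm.
rewrite leqNgt; apply/negP => big.
pose r := ('C(m.*2, d) - #|strip_set m L|).+1.
have rfg : (r <= \rank (gens_mx d (f, g)))%N.
  by rewrite rank_gens_mx /r; have := bound _ _ gram0; rewrite -/L; move: big; rewrite -/L; lia.
have [A [B]] := minor_of_rank rfg; apply/negP; rewrite negbK; apply/eqP.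
pose ell p := A *m gens_mx d p *m B.
pose W (p : E * E) := p.1 \in ext_deg k m.*2 2 /\ p.2 \in ext_deg k m.*2 2.
have -> : (f, g) = (f0, diag_form lam) + (f - f0, g - diag_form lam).
  by congr (_, _); rewrite /= addrC subrK.
apply: (@vanish_along_curves _ char0 _ r ell W); last 1 first.
- by split; apply: memvB => //; apply: diag_form_deg.
- by move=> a u v; rewrite /ell gens_mx_linear mulmxDr mulmxDl -scalemxAr -scalemxAl.
- by move=> a u v [u1 u2] [v1 v2]; split; rewrite memvD ?memvZ.
move=> [y1 y2] [/= y1d y2d].
have [eta [del [eta1 /= y1E y2E]]] := reachable_all lam_inj y1d y2d.
pose ee i := eta (lo i) * eta (hi i).
have ee2 i : ee i \in ext_deg k m.*2 2 by apply: (ext_deg_mul (eta1 _) (eta1 _)).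
have qv2 i : quad_variation eta i \in ext_deg k m.*2 2.
  by apply: memvD; [apply: (ext_deg_mul (eta1 _) (extX_deg k _))|apply: (ext_deg_mul (extX_deg k _) (eta1 _))].
pose H : 'M[k]_(m.*2) := \matrix_(j, l) eta j [set l].
pose P : 'M[{poly k}]_(m.*2) := 1%:M + 'X *: map_mx polyC H.
pose lamX i : {poly k} := (lam i)%:P + (del i) *: 'X.
have PE u : (\det P).[u] = \det (1%:M + u *: H).
  rewrite -[LHS]/(horner_eval u _) -det_map_mx; congr (\det _).
  apply/matrixP => i j; rewrite !mxE /= /horner_eval hornerD hornerM hornerX hornerC.
  by rewrite -polyC_natr hornerC.
have GE u : (\det (walk_gram L lamX)).[u] = \det (walk_gram L (fun i => lam i + u * del i)).
  rewrite -[LHS]/(horner_eval u _) -det_map_mx map_walk_gram; congr (\det _).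
  by apply: eq_walk_gram => i; rewrite /= /horner_eval !hornerE mulrC.
(* The terms of order 2 and 3 in u of the substituted pair. *)
exists (\sum_i ee i, \sum_i (lam i *: ee i + del i *: quad_variation eta i)).
exists (0, \sum_i del i *: ee i), (\det (walk_gram L lamX) * \det P); split.
- by split; apply: memv_suml => i _ //; rewrite memvD ?memvZ.
- by split; rewrite ?mem0v //; apply: memv_suml => i _; rewrite memvZ.
- apply/eqP => /(congr1 (horner_eval 0)); rewrite /horner_eval hornerM GE PE scale0r addr0 det1.
  rewrite mulr1 horner0; apply/eqP.
  by rewrite (@eq_walk_gram _ _ _ lam) // => i; rewrite mul0r addr0.
move=> u; rewrite hornerM GE PE mulf_eq0 negb_or => /andP[gu Pu].
pose xi j := X j + u *: eta j.
have xi1 j : xi j \in ext_deg k m.*2 1 by rewrite memvD ?memvZ ?extX_deg.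
have lift j : lifted_deg xi 1 (X j).
  pose Q := invmx (1%:M + u *: H).
  exists (\sum_i Q j i *: X i); first by apply: memv_suml => i _; rewrite memvZ ?extX_deg.
  rewrite raddf_sum /=.
  (* The matrix of the substitution is 1 + u H, with H the matrix of eta. *)
  have xiE i : xi i = \sum_l (1%:M + u *: H) i l *: X l.
    rewrite /xi (deg1_expand (eta1 i)) scaler_sumr {1}[X i](_ : _ = \sum_l (1%:M : 'M[k]_(m.*2)) i l *: X l).
      by rewrite -big_split; apply: eq_bigr => l _; rewrite !mxE scalerDl scalerA.
    rewrite (bigD1 i) //= big1 ?addr0 => [|l /negPf li]; first by rewrite mxE eqxx scale1r.
    by rewrite mxE eq_sym li scale0r.
  transitivity (\sum_l (Q *m (1%:M + u *: H)) j l *: X l).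
    under eq_bigr => i _ do rewrite linearZ /= subst_extX xiE scaler_sumr.
    rewrite exchange_big /=; apply: eq_bigr => l _; rewrite mxE scaler_suml.
    by apply: eq_bigr => i _; rewrite scalerA.
  rewrite mulVmx ?unitmxE ?unitfE // (bigD1 j) //= big1 ?addr0 => [|l /negPf lj].
    by rewrite mxE eqxx scale1r.
  by rewrite mxE eq_sym lj scale0r.
have quadS i : substitute xi (quad k i) = quad k i + u *: (quad_variation eta i + u *: ee i).
  rewrite /quad substM // !subst_extX // /xi /quad_variation /ee.
  rewrite mulrDl !mulrDr -!scalerAl -!scalerAr !scalerDr -!addrA.
  by congr (_ + _); rewrite [LHS]addrCA.
set p := (X in ell X).
have -> : p = (substitute xi f0, substitute xi (diag_form (fun i => lam i + u * del i))).
  rewrite /p; congr (_, _) => /=.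
    rewrite y1E scaler0 addr0 /diag_form [RHS]raddf_sum scaler_sumr -big_split scaler_sumr -big_split /=.
    by apply: eq_bigr => i _; rewrite linearZ /= quadS !scale1r.
  rewrite y2E /diag_form [RHS]raddf_sum scaler_sumr -big_split scaler_sumr -big_split scaler_sumr -big_split /=.
  apply: eq_bigr => i _; rewrite [RHS]linearZ /= quadS.
  move: (quad k i) (quad_variation eta i) (ee i) => q v w; apply/ffunP => S.
  by rewrite !ffunE /GRing.scale /=; ring.
apply/eqP/negPn/negP => /rank_of_minor; rewrite rank_gens_mx => h.
have := leq_trans h (dim_ideal_substitute char0 xi1 d f0 (diag_form (fun i => lam i + u * del i)) lift).
rewrite /r ltnNge => /negP[]; apply: leq_trans (leq_sub2r _ (bound _ _ gu)).
by rewrite addnK.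
Qed.
End AllPairs.

(** * The Zariski open set *)

Section Open.
Variables (k : fieldType) (V : vectType k).

Lemma det_linear_mpoly r (ell : V -> 'M[k]_r) : linear ell ->
  exists p : {mpoly k[dim V]}, forall v, p.@[fun i => v2r v 0 i] = \det (ell v).
Proof.
move=> lin; pose L : {linear V -> 'M[k]_r} := HB.pack ell (GRing.isLinear.Build _ _ _ _ ell lin).
have ellZ a u : ell (a *: u) = a *: ell u by exact: (linearZ_LR L).
exists (\det (\sum_i 'X_i *: map_mx (@mpolyC (dim V) k) (ell (r2v (delta_mx 0 i))))).
move=> v; rewrite -[LHS]/(meval (fun i => v2r v 0 i) _) -det_map_mx; congr (\det _).
have {2}-> : v = \sum_i v2r v 0 i *: r2v (delta_mx 0 i).
  apply: v2r_inj; rewrite raddf_sum [LHS]row_sum_delta.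
  by apply: eq_bigr => i _; rewrite /= linearZ /= r2vK.
rewrite -[ell _]/(L _) [RHS]raddf_sum; apply/matrixP => a b; rewrite mxE !summxE rmorph_sum.
by apply: eq_bigr => i _; rewrite /= ellZ !mxE rmorphM /= mevalXU mevalC.
Qed.
End Open.

Section Main.
Variables (k : fieldType) (m : nat).
Hypothesis char0 : [pchar k] =i pred0.
Local Notation E := (extalg k m.*2).
Local Notation E2 := (subvs_of (ext_deg k m.*2 2)).
Let V : vectType k := (E2 * E2)%type.

Let val2 (v : V) : E * E := (vsval v.1, vsval v.2).

Definition generic_rank (d : nat) : nat :=
  ('C(m.*2, d) - (if d <= m then #|strip_set m (m.+2 - d)| else 0))%N.

Lemma generic_point : exists v : V, forall d, (generic_rank d <= \rank (gens_mx d (val2 v)))%N.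
Proof.
have [lam det] := strip_determined_exists char0 m 1.
exists (vsproj _ (diag_form (fun=> 1)), vsproj _ (diag_form lam)) => d.
rewrite /val2 /= !vsprojK ?diag_form_deg // rank_gens_mx /generic_rank.
case: (leqP d m) => dm; last by rewrite subn0; apply: dim_ideal_diag_high.
by rewrite leq_subLR addnC; apply: dim_ideal_diag_ge => //; apply: det.
Qed.

(** On the open set where suitable minors do not vanish, the rank is at least its
value at one good diagonal pair, and [dim_ideal_le] bounds it above everywhere. *)
Lemma hilbert_coef_generic : generically (fun fg : V =>
  forall d, hilbert_coef (ext_ideal (vsval fg.1) (vsval fg.2)) d =
    if (d <= m)%N then #|strip_set m (m.+2 - d)| else 0%N).
Proof.
have [v0 rk0] := generic_point.
have minor d : exists p : {mpoly k[dim V]}, p.@[fun i => v2r v0 0 i] != 0 /\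
    forall v, p.@[fun i => v2r v 0 i] != 0 -> (generic_rank d <= \rank (gens_mx d (val2 v)))%N.
  have [A [B AB]] := minor_of_rank (rk0 d).
  have [|p pE] := @det_linear_mpoly k V _ (fun v => A *m gens_mx d (val2 v) *m B).
    move=> a u v; rewrite (_ : val2 _ = a *: val2 u + val2 v); last first.
      by congr (_, _); exact: linearP.
    by rewrite gens_mx_linear mulmxDr mulmxDl -scalemxAr -scalemxAl.
  by exists p; rewrite pE; split=> // v; rewrite pE => /rank_of_minor.
have {minor} /fin_all_exists[P hP] (d : 'I_(m.*2.+1)) := minor d.
pose p := \prod_d P d.
exists (fun v => p.@[fun i => v2r v 0 i] != 0); split.
- exists (fun q => q = p) => v; split=> [h|[q -> //]]; by exists p.
- exists v0; rewrite /p rmorph_prod; apply/prodf_neq0 => d _; exact: (hP d).1.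
move=> v; rewrite /p rmorph_prod => /prodf_neq0 hv d.
have f2 := subvsP v.1; have g2 := subvsP v.2.
have := hilbert_coefE d f2 g2; case: (leqP d m.*2) => d2m; last first.
  rewrite bin_small // => /eqP; rewrite addn_eq0 => /andP[/eqP -> _].
  by rewrite ifF //; apply/negbTE; rewrite -ltnNge; lia.
have := (hP (Ordinal (d2m : (d < m.*2.+1)%N))).2 v (hv _ isT).
rewrite /= rank_gens_mx /generic_rank; case: (leqP d m) => dm.
  have := dim_ideal_le char0 dm f2 g2.
  by move: (hilbert_coef _ _) (\dim _) (#|_|) => a b c; lia.
by move: (hilbert_coef _ _) (\dim _) => a b; lia.
Qed.

Lemma hilbert_coef0 f g : f \in ext_deg k m.*2 2 -> g \in ext_deg k m.*2 2 ->
  hilbert_coef (ext_ideal f g) 0 = 1%N.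
Proof.
move=> f2 g2; have := hilbert_coefE 0 f2 g2; rewrite bin0.
suff : (ideal_comp 0 f g <= 0)%VS by rewrite subv0 => /eqP ->; rewrite dimv0 addn0.
by apply: ideal_compP => T; rewrite addn2.
Qed.
End Main.

Lemma coef_hilbert_poly m i :
  (1 + \sum_(1 <= s < m.+1) (lattice_c m.*2 s)%:Z *: 'X^s : {poly int})`_i =
  if i == 0%N then 1 else if (i <= m)%N then (lattice_c m.*2 i)%:Z else 0.
Proof.
rewrite coefD coef1 coef_sum.
under eq_bigr => s _ do rewrite coefZ coefXn.
case: (posnP i) => [->|i0].
  rewrite big_nat_cond big1 ?addr0 // => s /andP[/andP[s1 _] _].
  by rewrite -(ltn_predK s1) mulr0.
rewrite /= add0r.
case: (leqP i m) => im.
  rewrite (bigD1_seq i) ?mem_index_iota ?iota_uniq //= ?i0 // eqxx mulr1 big1 ?addr0 // => s si.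
  by rewrite eq_sym (negPf si) mulr0.
rewrite big_nat_cond big1 // => s /andP[/andP[_ sm] _].
by case: eqP => [e|]; rewrite ?mulr0 //; lia.
Qed.



Theorem corollary5p6 (k : fieldType) (char0 : [pchar k] =i pred0)
    (n : nat) (n_gt0 : (0 < n)%N) (n_even : ~~ odd n) :
  generically
    (fun fg : (subvs_of (ext_deg k n 2) * subvs_of (ext_deg k n 2))%type =>
       forall i : nat,
         (hilbert_coef (ext_ideal (vsval fg.1) (vsval fg.2)) i)%:Z =
         (1 + \sum_(1 <= s < n./2.+1) (lattice_c n s)%:Z *: 'X^s : {poly int})`_i)
  /\
  (forall s : nat, (s <= n./2)%N ->
     let delta : int := n%:Z - 2 * s%:Z + 4 in
     (lattice_c n s)%:Z =
     \sum_(0 <= j < ((s + 2) %/ 3).+1)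
       (binz n (s%:Z - j%:Z * delta)
        - 2 * binz n (s%:Z - 2 - j%:Z * delta)
        + binz n (s%:Z - 4 - j%:Z * delta))).
Proof.
split; last by move=> s sn; apply: lattice_c_formula.
have nE : n = n./2.*2 by rewrite even_halfK.
move: (n./2) nE => m nE; subst n.
have [U [openU exU inU]] := hilbert_coef_generic m char0.
exists U; split=> // fg Ufg i; rewrite coef_hilbert_poly.
case: eqP => [->|_].
  by rewrite hilbert_coef0 ?subvsP.
by rewrite (inU fg Ufg i); case: (leqP i m) => im //; rewrite lattice_c_words.
Qed.
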